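(* There is a numerical constant $c_0$ such that the following holds. Let $N\ge1$, let $1\le p\le\infty$, and for $1\le i\le N$ let $(M_i,d_i)$ be a metric space of pointwise homogeneous type with respect to a family of Borel measures $\{\mu^i_m\}_{m\in M_i}$ with optimal constants $D_i$ (uniform doubling constant) and $C_i$ (consistency constant). Assume that $\{\mu_m^i\}_{m\in M_i}$ is $K_i$-uniform for all $1\le i\le N$. Let $(M,d_p)$ be the direct $p$-sum of the spaces $(M_i,d_i)$. Then for every subspace $S\subset M$ and every Banach space $X$, $$\lambda(S,M;X)\le c_0(\widetilde C_p+1)(\log_2\widetilde D+1),$$ where $$\widetilde D:=\prod_{i=1}^{N}D_i,\qquad \widetilde C_p:=\Big(\sum_{i=1}^{N}C_i^q\Big)^{1/q}\prod_{i=1}^{N}K_i,$$ and $q$ is related to $p$ by $\frac1p+\frac1q=1$.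
   Context: Balls: $B_R(m)=\{m' : d(m,m')<R\}$ is the open ball. Pointwise homogeneous type: a metric space $(M,d)$ with a family of Borel measures $\{\mu_m\}_{m\in M}$ on $M$ is of pointwise homogeneous type if (i) (uniform doubling) for every $m\in M$ every open ball centered at $m$ has finite strictly positive $\mu_m$-measure, and $D:=\sup_{m\in M}\sup_{R>0}\frac{\mu_m(B_{2R}(m))}{\mu_m(B_R(m))}<\infty$; (ii) (consistency with the metric) for some constant $C$, for all $m_1,m_2\in M$ and $R>0$, $$|\mu_{m_1}-\mu_{m_2}|(B_R(m))\le \frac{C\,\mu_m(B_R(m))}{R}\,d(m_1,m_2)\quad\text{for } m=m_1 \text{ and for } m=m_2,$$ where $|\cdot|$ denotes total variation. The optimal constants are $D$ as in (i) and the smallest $C\ge 0$ for which (ii) holds. $K$-uniformity ($K\ge1$): $\mu_{m_1}(B_R(m_1))\le K\mu_{m_2}(B_R(m_2))$ for all $m_1,m_2\in M$, $R>0$. Direct $p$-sum: underlying set $M=\prod_{i=1}^N M_i$, metric $d_p(m,m'):=\big(\sum_{i=1}^{N}d_i(m_i,m_i')^p\big)^{1/p}$ (for $p=\infty$, $d_\infty=\max_{1\le i\le N} d_i$). For $q=\infty$, $(\sum C_i^q)^{1/q}$ means $\max_i C_i$. Extension constant: for a Banach space $X$, $Lip(M,X)$ is the space of Lipschitz functions $f:M\to X$ with seminorm $L(f)=\sup_{m\ne m'}\|f(m)-f(m')\|/d(m,m')$; for $S\subset M$ (with the induced metric), $\lambda(S,M;X)$ is the infimum of the norms $\|T\|$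 of continuous linear operators $T:Lip(S,X)\to Lip(M,X)$ with $Tf|_S=f$ for all $f$ ($=\infty$ if there are none). *)

(* Defs.v *)
From HB Require Import structures.
From mathcomp Require Import all_boot all_order all_algebra.
From mathcomp Require Import all_classical all_reals all_analysis.

Set Implicit Arguments.
Unset Strict Implicit.
Unset Printing Implicit Defensive.

Import Order.TTheory GRing.Theory Num.Theory.
Import numFieldNormedType.Exports.

Local Open Scope classical_set_scope.
Local Open Scope ring_scope.

(* [measurableType] is only available over pointed types; the base point is
   otherwise unused, so this is the structure of a nonempty metric space. *)
#[short(type="pmetricType")]
HB.structure Definition PointedMetric (R : numDomainType) :=
  { M of Metric R M & Pointed M }.

Definition borel (T : ptopologicalType) := g_sigma_algebraType (@open T).

HB.instance Definition _ (T : ptopologicalType) := Measurable.on (borel T).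

(* [|mu - nu|(A)], by finite partitions.  The value is meaningful when [mu] and
   [nu] are finite on [A]: only then is [mu - nu] a signed measure on [A]. *)
Definition total_variation d (T : measurableType d) (R : realType)
    (mu nu : {measure set T -> \bar R}) (A : set T) : \bar R :=
  ereal_sup [set x | exists n (F : 'I_n -> set T),
    [/\ forall i, measurable (F i), trivIset setT F, \bigcup_i F i = A &
        x = (\sum_(i < n) `|mu (F i) - nu (F i)|)%E]].

Section PointwiseHomogeneous.
Context {R : realType} {M : pmetricType R}.
Variable mu : M -> {measure set (borel M) -> \bar R}.

Definition balls_finite_pos : Prop :=
  forall (m : M) (r : R), 0 < r -> (0 < mu m (ball m r) < +oo)%E.

Definition doubling_sup : \bar R :=
  ereal_sup [set x | exists (m : M) (r : R),
    0 < r /\ x = (mu m (ball m (2 * r)) / mu m (ball m r))%E].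

Definition uniform_doubling : Prop :=
  balls_finite_pos /\ (doubling_sup < +oo)%E.

Definition consistent_with (C : R) : Prop :=
  forall (m1 m2 : M) (r : R), 0 < r ->
  forall m : M, m = m1 \/ m = m2 ->
  (total_variation (mu m1) (mu m2) (ball m r)
    <= C%:E * mu m (ball m r) / r%:E * (mdist m1 m2)%:E)%E.

Definition pointwise_homogeneous : Prop :=
  uniform_doubling /\ exists C : R, consistent_with C.

Definition doubling_constant : R := fine doubling_sup.

(* The set below is closed, so this infimum is its least element as soon as
   the set is nonempty. *)
Definition consistency_constant : R :=
  inf [set C | 0 <= C /\ consistent_with C].

Definition uniform_family (K : R) : Prop :=
  forall (m1 m2 : M) (r : R), 0 < r ->
  (mu m1 (ball m1 r) <= K%:E * mu m2 (ball m2 r))%E.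

End PointwiseHomogeneous.

(* [(\sum_i (a i)^p)^(1/p)] for [1 <= p < +oo] and [max_i (a i)] for [p = +oo];
   only used for nonnegative [a]. *)
Definition psum_norm (R : realType) (N : nat) (p : \bar R) (a : 'I_N -> R) : R :=
  match p with
  | r%:E => (\sum_(i < N) a i `^ r) `^ r^-1
  | +oo%E => \big[Num.max/0]_(i < N) a i
  | -oo%E => 0
  end.

Definition psum_dist (R : realType) (N : nat) (M : 'I_N -> pmetricType R)
    (p : \bar R) (x y : forall i, M i) : R :=
  psum_norm p (fun i => mdist (x i) (y i)).

Section LipschitzSpace.
Context {R : realType} {T : Type} (d : T -> T -> R) (X : normedModType R).

Definition lipschitz_wrt (f : T -> X) : Prop :=
  exists k : R, forall x y, `|f x - f y| <= k * d x y.

Definition lip_pred : {pred T -> X} := mem [set f | lipschitz_wrt f].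

Record Lip := MkLip { lip_fun :> T -> X ; _ : lip_fun \in lip_pred }.

HB.instance Definition _ := [isSub for lip_fun].
HB.instance Definition _ := [Choice of Lip by <:].

Lemma lip_pred_submod : submod_closed lip_pred.
Proof.
split=> [|a f g].
  by rewrite inE; exists 0 => x y; rewrite subrr normr0 mul0r.
rewrite !inE => -[k fk] [l gl]; exists (`|a| * k + l) => x y.
have -> : (a *: f + g) x - (a *: f + g) y = a *: (f x - f y) + (g x - g y).
  by rewrite scalerBr addrACA -opprD.
rewrite (le_trans (ler_normD _ _))// normrZ mulrDl -mulrA lerD//.
by rewrite ler_wpM2l.
Qed.

HB.instance Definition _ :=
  GRing.isSubmodClosed.Build R (T -> X) lip_pred lip_pred_submod.
HB.instance Definition _ := [SubChoice_isSubLmodule of Lip by <:].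

Definition lip_seminorm (f : Lip) : R :=
  sup [set z | exists x y : T, x <> y /\ z = `|f x - f y| / d x y].

End LipschitzSpace.

Section Extension.
Context {R : realType} {M : Type} (d : M -> M -> R) (S : set M).
Variable X : normedModType R.

Definition induced_dist (x y : S) : R := d (val x) (val y).

Implicit Type T : {linear Lip induced_dist X -> Lip d X}.

Definition lip_continuous T : Prop :=
  forall (f : Lip induced_dist X) (e : R), 0 < e ->
  exists2 delta : R, 0 < delta & forall g : Lip induced_dist X,
    lip_seminorm (g - f) < delta -> lip_seminorm (T g - T f) < e.

Definition op_norm T : \bar R :=
  ereal_sup [set (lip_seminorm (T f))%:E | f in [set f | lip_seminorm f <= 1]].

Definition extends T : Prop :=
  forall (f : Lip induced_dist X) (x : S), T f (val x) = f x.

(* [ereal_inf set0 = +oo]: no extension operator means constant [+oo]. *)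
Definition extension_constant : \bar R :=
  ereal_inf [set op_norm T | T in [set T | lip_continuous T /\ extends T]].

End Extension.

(* Main.v *)
(* For a factor and a radius [r], averaging the normalized measures
   [mu m (_ `&` ball m s) / mu m (ball m s)] over [s] in [r / 2, r] gives
   probabilities [P m] on the ball of radius [r] about [m] with
   [|P m - P m'| <= c (C + log D + 1) d(m, m') / r]: consistency bounds the effect
   of changing the measure, and changing the centre costs the mean over [s] of the
   increments of the monotone function [ln (mu m (ball m s))], whose total increase is at
   most [3 ln D].

   In a product the i-th factor is averaged at radius [t (n_i / n)^(1/p)], where
   [n_i = log2 D_i] and [n] is essentially [\sum_i n_i]. These radii have
   p-norm at most [t], and since total variations of product measures add up,
   Hoelder's inequality bounds the variation of the averages by
   [c (|C|_q + 1) n d_p(m, m') / t]. This uses [n_i >= 1/2] for every factor with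
   at least two points. Averaging the values at nearly nearest points of [S], at a
   scale [t] comparable to the distance to [S], is then the required extension.

   The space need not be separable, so an [X]-valued function cannot simply be
   integrated against [P m]. At each scale a maximal family of mutually singular
   restrictions of the measures [mu m] is fixed (Zorn), and every [P m] is
   replaced by the list of its masses absolutely continuous with respect to the
   members of the family. At most countably many are nonzero and they add up to
   1; a soft threshold leaves finitely many of them. *)
Require Import Defs.
From HB Require Import structures.
From mathcomp Require Import finmap.
From mathcomp Require Import all_boot all_order all_algebra.
From mathcomp Require Import all_classical all_reals all_analysis.
From mathcomp Require Import ring lra zify.

Set Implicit Arguments.
Unset Strict Implicit.
Unset Printing Implicit Defensive.

Import Order.TTheory GRing.Theory Num.Theory.
Import numFieldNormedType.Exports.

Local Open Scope classical_set_scope.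
Local Open Scope ring_scope.

(** * Lipschitz spaces and extension operators *)

Section DistanceFunctions.
Context {R : realType} {T : Type}.
Implicit Type d : T -> T -> R.

(** A predicate on a bare distance function, because [psum_dist] varies with [p] and neither it nor
    [induced_dist] comes as a metric structure on its carrier. *)
Definition is_metric d :=
  [/\ forall x, d x x = 0, forall x y, d x y = d y x,
      forall x y z, d x z <= d x y + d y z & forall x y, d x y = 0 -> x = y].

Lemma is_metric_ge0 d : is_metric d -> forall x y, 0 <= d x y.
Proof.
move=> [d0 ds dt _] x y; have := dt x y x.
by rewrite d0 (ds y x); lra.
Qed.

Lemma is_metric_gt0 d : is_metric d -> forall x y, x <> y -> 0 < d x y.
Proof.
move=> dm x y xy; rewrite lt_neqAle is_metric_ge0// andbT eq_sym.
by apply/eqP => /(let: And4 _ _ _ h := dm in h).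
Qed.

End DistanceFunctions.

Lemma is_metric_induced (R : realType) (T : Type) (d : T -> T -> R) (S : set T) :
  is_metric d -> is_metric (induced_dist d (S := S)).
Proof.
case=> d0 ds dt dp; split=> *; rewrite /induced_dist; [exact: d0|exact: ds|exact: dt|].
exact/val_inj/dp.
Qed.

Section LipSeminorm.
Context {R : realType} {T : Type} (d : T -> T -> R) (X : normedModType R).
Hypothesis dm : is_metric d.
Implicit Type f : Lip d X.

Let slopes f := [set z | exists x y : T, x <> y /\ z = `|f x - f y| / d x y].

Let slopes_le f k : (forall x y, `|f x - f y| <= k * d x y) -> ubound (slopes f) k.
Proof.
move=> fk z [x [y [xy ->]]].
by rewrite ler_pdivrMr ?fk// (is_metric_gt0 dm).
Qed.

Lemma lip_seminormP f x y : `|f x - f y| <= lip_seminorm f * d x y.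
Proof.
have [->|xy] := pselect (x = y).
  by case: dm => -> _ _ _; rewrite subrr normr0 mulr0.
rewrite -ler_pdivrMr ?(is_metric_gt0 dm)//.
apply: ub_le_sup; last by exists x, y.
have := valP f; rewrite inE => -[k fk].
by exists k; exact: slopes_le.
Qed.

Lemma lip_seminorm_le f k : 0 <= k ->
  (forall x y, `|f x - f y| <= k * d x y) -> lip_seminorm f <= k.
Proof.
move=> k0 fk; rewrite /lip_seminorm -/(slopes f).
have [->|] := eqVneq (slopes f) set0; first by rewrite sup0.
by move=> /set0P ne; apply: ge_sup => //; exact: slopes_le.
Qed.

Lemma lip_seminorm_ge0 f : 0 <= lip_seminorm f.
Proof.
rewrite /lip_seminorm -/(slopes f).
have [->|] := eqVneq (slopes f) set0; first by rewrite sup0.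
move=> /set0P[z [x [y [xy ze]]]].
rewrite -(pmulr_lge0 _ (is_metric_gt0 dm xy)).
by apply: le_trans (lip_seminormP f x y).
Qed.

End LipSeminorm.

(** Reduces the task to a linear rule [E] on functions that multiplies Lipschitz constants by at
    most [B]: taking [L] to be the seminorm bounds the operator norm, and linearity turns the same
    bound into continuity. *)
Lemma extension_constant_le (R : realType) (T : Type) (d : T -> T -> R)
    (S : set T) (X : normedModType R) (B : R)
    (E : Lip (induced_dist d (S := S)) X -> T -> X) :
  is_metric d -> 0 <= B ->
  (forall a (f g : Lip (induced_dist d (S := S)) X) x, E (a *: f + g) x = a *: E f x + E g x) ->
  (forall (f : Lip (induced_dist d (S := S)) X) (x : S), E f (val x) = f x) ->
  (forall (f : Lip (induced_dist d (S := S)) X) (L : R), 0 <= L ->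
    (forall x y : S, `|f x - f y| <= L * d (val x) (val y)) ->
    forall x y, `|E f x - E f y| <= B * L * d x y) ->
  (extension_constant d S X <= B%:E)%E.
Proof.
move=> dm B0 Elin Eext Ele.
have dS := is_metric_induced S dm.
have EL f x y : `|E f x - E f y| <= B * lip_seminorm f * d x y.
  apply: Ele => [|u v]; first exact: lip_seminorm_ge0.
  exact: (lip_seminormP dS).
have Elip f : E f \in @lip_pred R T d X.
  by rewrite inE; exists (B * lip_seminorm f) => x y; exact: EL.
pose F f := MkLip (Elip f).
have Flin : linear F.
  by move=> a f g; apply/val_inj/funext => x /=; rewrite Elin.
pose G : {linear Lip (induced_dist d (S := S)) X -> Lip d X} :=
  
  HB.pack F (GRing.isLinear.Build _ _ _ _ F Flin).
have Gle f : lip_seminorm (G f) <= B * lip_seminorm f.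
  apply: lip_seminorm_le => // [|x y]; last exact: EL.
  by rewrite mulr_ge0// lip_seminorm_ge0.
apply: ge_ereal_inf; exists (op_norm G); last first.
  apply: ge_ereal_sup => _ [f /= f1 <-]; rewrite lee_fin.
  by rewrite (le_trans (Gle f))// ler_piMr.
exists G => //; split; last exact: Eext.
(* [B + 1] is used because [B] may be 0. *)
move=> f e e0; exists (e / (B + 1)); first by rewrite divr_gt0// ltr_wpDl.
move=> g; rewrite ltr_pdivlMr ?ltr_wpDl// => gf.
rewrite -linearB (le_lt_trans (Gle _))//.
rewrite (le_lt_trans _ gf)// mulrC ler_wpM2l ?lerDl//.
exact: lip_seminorm_ge0.
Qed.

(** * Extension by values at almost nearest points of [S] *)

Section AlmostExtension.
Context {R : realType} {T : Type} (d : T -> T -> R) (S : set T).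
Variable X : completeNormedModType R.
Hypotheses (dm : is_metric d) (S0 : S !=set0).

Definition dist_to (x : T) : R := inf [set d x s | s in S].

Let dist_ge0 := is_metric_ge0 dm.

Let dist_lb x : lbound [set d x s | s in S] 0.
Proof. by move=> _ [s _ <-]. Qed.

Let dist_ne x : [set d x s | s in S] !=set0.
Proof. by have [s Ss] := S0; exists (d x s), s. Qed.

Lemma dist_to_ge0 x : 0 <= dist_to x.
Proof. exact: lb_le_inf. Qed.

Lemma dist_to_le x s : S s -> dist_to x <= d x s.
Proof. by move=> Ss; apply: ge_inf; [exists 0; exact: dist_lb|exists s]. Qed.

Lemma dist_to_mem s : S s -> dist_to s = 0.
Proof.
move=> Ss; apply/eqP; rewrite eq_le dist_to_ge0 andbT.
by rewrite (le_trans (dist_to_le s Ss))//; case: dm => ->.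
Qed.

Lemma dist_to_lipschitz x y : dist_to x <= dist_to y + d x y.
Proof.
rewrite -lerBlDr; apply: lb_le_inf => // _ [s Ss <-].
rewrite lerBlDr (le_trans (dist_to_le x Ss))//.
by case: dm => _ _ dt _; rewrite addrC; exact: dt.
Qed.

Lemma dist_to_adherent x e : 0 < e -> exists s : S, d x (val s) < dist_to x + e.
Proof.
move=> e0; have [|_ [s Ss <-] se] := inf_adherent (E := [set d x s | s in S]) e0.
  by split; [exact: dist_ne|exists 0; exact: dist_lb].
by exists (SigSub (mem_set Ss)).
Qed.

(** At positive distance from [S] one point, chosen with tolerance [dist_to x], serves for all [n],
    so no limit is taken there. Only on the closure of [S] does the error [n.+1%:R^-1] matter. *)
Let nearby : exists s : T -> nat -> S,
  (forall x n, d x (val (s x n)) <= 2 * dist_to x + n.+1%:R^-1) /\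
  forall x n, 0 < dist_to x -> s x n = s x 0.
Proof.
have /choice[s sP] : forall x, exists s : nat -> S,
    (forall n, d x (val (s n)) <= 2 * dist_to x + n.+1%:R^-1) /\
    forall n, 0 < dist_to x -> s n = s 0.
  move=> x; have := dist_to_ge0 x; rewrite le_eqVlt => /predU1P[x0|x0].
    have /choice[s sP] n : exists s : S, d x (val s) < dist_to x + n.+1%:R^-1.
      by apply: dist_to_adherent; rewrite invr_gt0.
    exists s; split=> [n|n]; last by rewrite -x0 ltxx.
    by rewrite (le_trans (ltW (sP n)))// -x0 mulr0.
  have [s sx] := dist_to_adherent x x0.
  exists (fun=> s); split=> // n; rewrite (le_trans (ltW sx))//.
  by rewrite mulr_natl mulr2n lerDl invr_ge0.
exists s; split=> x n; first exact: (sP x).1.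
exact: (sP x).2.
Qed.

(* Values at an almost nearest point of [S], or a limit of values if [x] is in
   the closure of [S]; the result is Lipschitz at scales above [dist_to]. *)
Lemma almost_extension :
  exists g : Lip (induced_dist d (S := S)) X -> T -> X,
  [/\ forall a (f h : Lip (induced_dist d (S := S)) X) x,
        g (a *: f + h) x = a *: g f x + g h x,
      forall (f : Lip (induced_dist d (S := S)) X) (x : S), g f (val x) = f x &
      forall (f : Lip (induced_dist d (S := S)) X) (L : R), 0 <= L ->
      (forall x y : S, `|f x - f y| <= L * d (val x) (val y)) ->
      forall x y,
      `|g f x - g f y| <= L * (d x y + 2 * dist_to x + 2 * dist_to y)].
Proof.
case: (dm) => d0 ds dt dp.
have [s [sle scst]] := nearby.
have dss x n k : d (val (s x n)) (val (s x k)) <=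
    4 * dist_to x + n.+1%:R^-1 + k.+1%:R^-1.
  have := dt (val (s x n)) x (val (s x k)).
  rewrite (ds (val (s x n)) x); have := sle x n; have := sle x k.
  by set p := _^-1; set q := _^-1; lra.
have lip0 (f : Lip (induced_dist d (S := S)) X) : exists2 L, 0 <= L &
    forall x y : S, `|f x - f y| <= L * d (val x) (val y).
  have := valP f; rewrite inE => -[k fk]; exists `|k| => // u v.
  by rewrite (le_trans (fk u v))// ler_wpM2r ?ler_norm// /induced_dist.
have fcvg (f : Lip (induced_dist d (S := S)) X) x :
    cvg (f (s x n) @[n --> \oo]).
  have := dist_to_ge0 x; rewrite le_eqVlt => /predU1P[x0|x0]; last first.
    under eq_fun do rewrite scst//; exact: is_cvg_cst.
  have [L L0 fL] := lip0 f.
  (* Here [dist_to x = 0], so the chosen points are Cauchy, and completeness of [X] supplies the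
     limit. *)
  apply/cauchy_cvgP/cauchy_exP => e e0.
  have e1 : 0 < e / (2 * L + 1) by rewrite divr_gt0// ltr_wpDl// mulr_ge0.
  have [N _ Ne] := near_infty_natSinv_lt (PosNum e1).
  exists (f (s x N)); exists N => // n /= Nn; rewrite -ball_normE/=.
  rewrite (le_lt_trans (fL _ _))//; have := dss x N n; rewrite -x0 mulr0 add0r.
  have := Ne N (leqnn N); have := Ne n Nn => /=.
  rewrite !ltr_pdivlMr ?ltr_wpDl ?mulr_ge0//; set p := _^-1; set q := _^-1.
  have p0 : 0 <= p by rewrite invr_ge0.
  have q0 : 0 <= q by rewrite invr_ge0.
  by nra.
pose g (f : Lip (induced_dist d (S := S)) X) x := lim (f (s x n) @[n --> \oo]).
(* The estimates below replace the limit by a single term [f (s x n)] and let [e] tend to 0. *)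
have gnear (f : Lip (induced_dist d (S := S)) X) x e : 0 < e ->
    exists n, n.+1%:R^-1 < e /\ `|g f x - f (s x n)| <= e.
  move=> e0; have [N _ Ne] := near_infty_natSinv_lt (PosNum e0).
  have [K _ Ke] := cvgr_dist_le _ _ (fcvg f x) _ e0.
  exists (maxn N K); split; first by apply: Ne => /=; rewrite leq_maxl.
  by apply: Ke => /=; rewrite leq_maxr.
have gS (f : Lip (induced_dist d (S := S)) X) (x : S) : g f (val x) = f x.
  have [L L0 fL] := lip0 f.
  apply/eqP; rewrite -subr_eq0 -normr_le0; apply/ler_addgt0Pl => e e0.
  have e1 : 0 < e / (L + 1) by rewrite divr_gt0// ltr_wpDl.
  have [n [ne gn]] := gnear f (val x) _ e1.
  rewrite addr0 (le_trans (ler_distD (f (s (val x) n)) _ _))//.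
  have := fL (s (val x) n) x; have := sle (val x) n.
  rewrite dist_to_mem; last exact: set_valP.
  rewrite mulr0 add0r ds => dn fn; rewrite (le_trans (lerD gn fn))//.
  have := ler_wpM2l L0 (le_trans dn (ltW ne)).
  have eL : (L + 1) * (e / (L + 1)) = e.
    by rewrite mulrC divfK// gt_eqF// ltr_wpDl.
  by move: eL; set E := e / _; nra.
exists g; split => // [a f h x|f L L0 fL x y].
  rewrite -limZr// -limD//; last exact: is_cvgZr.
apply/ler_addgt0Pl => e e0.
have e1 : 0 < e / (2 * (L + 1)) by rewrite divr_gt0// mulr_gt0// ltr_wpDl.
have [n [ne gn]] := gnear f x _ e1.
have [k [ke gk]] := gnear f y _ e1.
rewrite (le_trans (ler_distD (f (s x n)) _ _))//.
rewrite (le_trans (lerD gn (ler_distD (f (s y k)) _ _)))//.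
rewrite distrC in gk; rewrite (le_trans (lerD (lexx _) (lerD (fL _ _) gk)))//.
have := dt (val (s x n)) x (val (s y k)); rewrite (ds (val (s x n)) x).
have := dt x y (val (s y k)); have := sle x n; have := sle y k.
move=> h1 h2 h3 h4.
have h5 : d (val (s x n)) (val (s y k)) <=
    d x y + 2 * dist_to x + 2 * dist_to y + 2 * (e / (2 * (L + 1))).
    by move: ne ke h1 h2; set p := n.+1%:R^-1; set q := k.+1%:R^-1; set E := e / _; lra.
have := ler_wpM2l L0 h5.
have eL : 2 * (L + 1) * (e / (2 * (L + 1))) = e.
  by rewrite mulrC divfK// gt_eqF// mulr_gt0// ltr_wpDl.
by move: eL; set E := e / _; nra.
Qed.

End AlmostExtension.

(** * Dyadic scales *)

Section DyadicScale.
Context {R : realType}.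

(* The power of [2] in the interval ]r / 2, r]. *)
Definition dyadic_scale (r : R) : R := expR ((Num.floor (ln r / ln 2))%:~R * ln 2).

Implicit Type r : R.

Lemma dyadic_scale_gt0 r : 0 < dyadic_scale r.
Proof. exact: expR_gt0. Qed.

Let ln2_gt0 : 0 < ln 2 :> R.
Proof. by rewrite ln_gt0// ltr1n. Qed.

Let double_expR (z : R) : 2 * expR (z * ln 2) = expR ((z + 1) * ln 2) :> R.
Proof. by rewrite [in RHS]mulrDl mul1r expRD lnK ?posrE// mulrC. Qed.

Lemma dyadic_scale_itv r : 0 < r -> dyadic_scale r <= r < 2 * dyadic_scale r.
Proof.
move=> r0; rewrite /dyadic_scale double_expR -{2 3}(lnK r0) ler_expR ltr_expR.
rewrite -ler_pdivlMr// -ltr_pdivrMr//.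
by have := floor_itv (ln r / ln 2); rewrite intrD.
Qed.

(** The base 2 logarithm grows by less than 1 from [r] to [r'], so its floor grows by at most 1. *)
Lemma dyadic_scale_near r r' : 0 < r -> r <= r' -> r' < 2 * r ->
  dyadic_scale r' = dyadic_scale r \/ dyadic_scale r' = 2 * dyadic_scale r.
Proof.
move=> r0 rr' r'2.
have r'0 : 0 < r' by exact: lt_le_trans rr'.
have h1 : (Num.floor (ln r / ln 2) <= Num.floor (ln r' / ln 2))%R.
  by apply: le_floor; rewrite ler_pM2r ?invr_gt0// ler_ln.
have h2 : (Num.floor (ln r' / ln 2) < Num.floor (ln r / ln 2) + 2)%R.
  rewrite -(ltr_int R) intrD (le_lt_trans (floor_le _))//.
  have lt2 : ln r' / ln 2 < ln r / ln 2 + 1.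
    rewrite -ltrBlDl -mulrBl ltr_pdivrMr// mul1r ltrBlDl.
    by rewrite -lnM ?posrE// ltr_ln ?posrE ?mulr_gt0// mulrC.
  by have := floorD1_gt (ln r / ln 2); rewrite intrD; lra.
have [e|/eqP ne] := eqVneq (Num.floor (ln r' / ln 2)) (Num.floor (ln r / ln 2)).
  by left; rewrite /dyadic_scale e.
right; rewrite /dyadic_scale double_expR.
suff -> : Num.floor (ln r' / ln 2) = Num.floor (ln r / ln 2) + 1.
  by rewrite intrD.
by lia.
Qed.

End DyadicScale.

(** * Extension from means at all scales *)

Section ExtensionFromMeans.
Context {R : realType} {T : Type} (d : T -> T -> R) (S : set T).
Variables (X : completeNormedModType R) (Lam : R) (A : R -> (T -> X) -> T -> X).
Hypotheses (dm : is_metric d) (Lam1 : 1 <= Lam).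
Hypothesis A_linear : forall (t : R) a g h x, 0 < t ->
  A t (fun y => a *: g y + h y) x = a *: A t g x + A t h x.
(** [A t g x] stands for an average of [g] over the [2 * t]-neighbourhood of [x]. Measuring the
    oscillation about an arbitrary [c] encodes total mass 1: for [b = 0] constants are
    reproduced. *)
Hypothesis A_mean : forall (t : R) g x c (b : R), 0 < t ->
  (forall y, d x y <= 2 * t -> `|g y - c| <= b) -> `|A t g x - c| <= b.
Hypothesis A_lipschitz : forall (t : R) g x x' c (b : R), 0 < t ->
  (forall y, d x y <= 2 * t + d x x' -> `|g y - c| <= b) ->
  `|A t g x - A t g x'| <= Lam * d x x' / t * b.

(* Without the interpolation in [r] the operator would jump with the dyadic scale. *)
Let interp (g : T -> X) (r : R) (x : T) : X :=
  let t := dyadic_scale r in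
  (2 - r / t) *: A t g x + (r / t - 1) *: A (2 * t) g x.

Let dge0 := is_metric_ge0 dm.

(** This expands about the lower node of the interpolation, [interpE2] about the upper one. For
    radii in adjacent dyadic intervals the upper node of one is the lower node of the other, and the
    two expansions cancel there. *)
Let interpE1 g r x : interp g r x = A (dyadic_scale r) g x +
  (r / dyadic_scale r - 1) *:
    (A (2 * dyadic_scale r) g x - A (dyadic_scale r) g x).
Proof.
rewrite /interp; set q := _ - 1; have -> : 2 - r / dyadic_scale r = 1 - q.
  by rewrite /q; ring.
clearbody q; by rewrite scalerBl scale1r scalerBr -addrA [in RHS](addrC (_ *: A _ g x)).
Qed.

Let interpE2 g r x : interp g r x = A (2 * dyadic_scale r) g x -
  (2 - r / dyadic_scale r) *:
    (A (2 * dyadic_scale r) g x - A (dyadic_scale r) g x).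
Proof.
rewrite /interp; set q := 2 - _; have -> : r / dyadic_scale r - 1 = 1 - q.
  by rewrite /q; ring.
clearbody q; by rewrite scalerBl scale1r scalerBr opprB addrCA.
Qed.

Section FixedFunction.
Variables (g : T -> X) (L : R).
Hypothesis L0 : 0 <= L.
Hypothesis gL : forall x y,
  `|g x - g y| <= L * (d x y + 2 * dist_to d S x + 2 * dist_to d S y).
Hypothesis S0 : S !=set0.
Local Notation rho := (dist_to d S).

Let g_near x y : `|g y - g x| <= L * (3 * d x y + 4 * rho x).
Proof.
rewrite (le_trans (gL _ _))// ler_wpM2l//.
have := dist_to_lipschitz dm S0 y x; have -> : d y x = d x y by case: dm.
lra.
Qed.

Let A_near (t : R) x : 0 < t -> `|A t g x - g x| <= L * (6 * t + 4 * rho x).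
Proof.
move=> t0; apply: A_mean => // y xy; rewrite (le_trans (g_near _ _))//.
by rewrite ler_wpM2l//; lra.
Qed.

Let weights (r : R) : 0 < r ->
  0 <= 2 - r / dyadic_scale r /\ 0 <= r / dyadic_scale r - 1.
Proof.
move=> r0; have /andP[h1 h2] := dyadic_scale_itv r0.
rewrite !subr_ge0 ler_pdivrMr ?dyadic_scale_gt0// ler_pdivlMr ?dyadic_scale_gt0//.
by rewrite mul1r h1 (ltW h2).
Qed.

Let interp_near x : 0 < rho x -> `|interp g (rho x) x - g x| <= 16 * L * rho x.
Proof.
move=> r0; have [h1 h2] := weights r0.
have /andP[t1 t2] := dyadic_scale_itv r0; rewrite /interp.
set t := dyadic_scale _ in h1 h2 t1 t2 *.
have t0 : 0 < t by exact: dyadic_scale_gt0.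
set a := 2 - _ in h1 *; set b := _ - 1 in h2 *.
have ab : a + b = 1 by rewrite /a /b; ring.
have -> : a *: A t g x + b *: A (2 * t) g x - g x =
    a *: (A t g x - g x) + b *: (A (2 * t) g x - g x).
  by rewrite !scalerBr addrACA -opprD -scalerDl ab scale1r.
rewrite (le_trans (ler_normD _ _))// !normrZ !ger0_norm//.
have t20 : 0 < 2 * t by rewrite mulr_gt0.
have k1 := ler_wpM2l h1 (A_near x t0); have k2 := ler_wpM2l h2 (A_near x t20).
rewrite (le_trans (lerD k1 k2))//.
have -> : 16 * L * rho x = a * (L * (16 * rho x)) + b * (L * (16 * rho x)).
  by rewrite -mulrDl ab; ring.
by rewrite lerD// ler_wpM2l// ler_wpM2l//; lra.
Qed.

(** On a dyadic interval with lower end [t] the interpolation is affine in [r], with slope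
    [(A (2 * t) g x - A t g x) / t]. Both means are within order [L * t] of [g x], and since
    [r' < 2 * r] at most two intervals are met. *)
Let interp_scale x (r r' : R) : 0 < r -> r <= r' -> r' < 2 * r -> rho x <= r' ->
  `|interp g r' x - interp g r x| <= 56 * L * (r' - r).
Proof.
move=> r0 rr' r'2 xr'.
have r'0 : 0 < r' by exact: lt_le_trans rr'.
have gap (t : R) : 0 < t -> rho x <= 4 * t ->
    `|A (2 * t) g x - A t g x| <= 56 * L * t.
  move=> t0 xt; rewrite (le_trans (ler_distD (g x) _ _))// (distrC (g x)).
  have t20 : 0 < 2 * t by rewrite mulr_gt0.
  have := A_near x t0; have := A_near x t20.
  by have := ler_wpM2l L0 xt; have := mulr_ge0 L0 (ltW t0); lra.
have /andP[t1 t2] := dyadic_scale_itv r0.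
have /andP[t1' t2'] := dyadic_scale_itv r'0.
have t0 := dyadic_scale_gt0 r.
have [e|e] := dyadic_scale_near r0 rr' r'2.
- rewrite !interpE1 e in t1' t2' *; set t := dyadic_scale r in t0 t1 t2 t1' t2' *.
  rewrite opprD addrACA subrr add0r -scalerBl.
  have -> : r' / t - 1 - (r / t - 1) = (r' - r) / t by ring.
  have w0 : 0 <= (r' - r) / t by rewrite divr_ge0 ?subr_ge0// ltW.
  rewrite normrZ ger0_norm// (le_trans (ler_wpM2l w0 (gap t t0 _)))//; first lra.
  by rewrite mulrCA divfK ?gt_eqF.
- rewrite interpE1 interpE2 e in t1' t2' *.
  set t := dyadic_scale r in t0 t1 t2 t1' t2' *.
  have t20 : 0 < 2 * t by rewrite mulr_gt0.
  rewrite opprB addrC addrA subrK addrC.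
  rewrite (le_trans (ler_normD _ _))// !normrZ.
  have [w1 w2] := (weights r'0, weights r0); rewrite e -/t in w1 w2.
  rewrite (ger0_norm w2.1) (ger0_norm w1.2).
  have xt : rho x <= 4 * t by lra.
  have xt2 : rho x <= 4 * (2 * t) by lra.
  rewrite (le_trans (lerD (ler_wpM2l w1.2 (gap _ t20 xt2)) (ler_wpM2l w2.1 (gap _ t0 xt))))//.
  have e1 : r' / (2 * t) * (2 * t) = r' by rewrite divfK// gt_eqF.
  have e2 : r / t * t = r by rewrite divfK// gt_eqF.
  rewrite -subr_ge0; set u := r' / _ in e1 *; set v := r / _ in e2 *.
  have -> : 56 * L * (r' - r) - ((u - 1) * (56 * L * (2 * t)) + (2 - v) * (56 * L * t))
     = 56 * L * ((r' - u * (2 * t)) - (r - v * t)) by ring.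
  by rewrite e1 e2 !subrr mulr0.
Qed.

Let interp_point x x' (r : R) : 0 < r -> rho x <= r -> d x x' <= r / 2 ->
  `|interp g r x - interp g r x'| <= 46 * Lam * L * d x x'.
Proof.
move=> r0 xr xx'.
have [w1 w2] := weights r0; have /andP[t1 t2] := dyadic_scale_itv r0.
have t0 := dyadic_scale_gt0 r; rewrite /interp.
set t := dyadic_scale r in w1 w2 t0 t1 t2 *; set q := r / t in w1 w2 *.
(* The factor [d x x' / s] meets an oscillation of order [L * s] about [g x], so the scale cancels.
   The range of [s] includes both nodes [t] and [2 * t]. *)
have Lt s : t <= s -> s <= 2 * t ->
    `|A s g x - A s g x'| <= Lam * d x x' * (46 * L).
  move=> ts st; have s0 : 0 < s by exact: lt_le_trans ts.
  have Ls : `|A s g x - A s g x'| <= Lam * d x x' / s * (L * (9 * s + 14 * t)).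
    apply: (A_lipschitz (c := g x)) => // y xy; rewrite (le_trans (g_near _ _))//.
    by rewrite ler_wpM2l//; lra.
  rewrite (le_trans Ls)// -!mulrA ler_wpM2l ?(le_trans _ Lam1)//.
  rewrite ler_wpM2l// mulrC ler_pdivrMr// -mulrA mulrCA ler_wpM2l//; lra.
rewrite opprD addrACA -!scalerBr (le_trans (ler_normD _ _))// !normrZ.
rewrite (ger0_norm w1) (ger0_norm w2).
have h1 := ler_wpM2l w1 (Lt t (lexx _) (ltac:(lra))).
have h2 := ler_wpM2l w2 (Lt (2 * t) (ltac:(lra)) (lexx _)).
by rewrite (le_trans (lerD h1 h2))// -mulrDl; nra.
Qed.

Let ext (x : T) : X := if rho x == 0 then g x else interp g (rho x) x.

Let ext_near x : `|ext x - g x| <= 16 * L * rho x.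
Proof.
rewrite /ext; case: ifPn => [/eqP->|x0].
  by rewrite subrr normr0 mulr0.
by apply: interp_near; rewrite lt_neqAle eq_sym x0 dist_to_ge0.
Qed.

(** If the larger distance to [S] is at most [4 * d x x'], comparing [ext] with [g] at both points
    costs [64 + 17 + 64] times [L * d x x']. Otherwise the radius is changed at [x'] and then the
    point at radius [rho x], which costs [56 + 46] times [Lam * L * d x x']. *)
Lemma ext_lipschitz x x' : `|ext x - ext x'| <= 200 * Lam * L * d x x'.
Proof.
wlog le_xx' : x x' / rho x <= rho x' => [H|].
  have [|/ltW] := leP (rho x) (rho x'); first exact: H.
  by move=> /H; rewrite distrC (let: And4 _ h _ _ := dm in h x').
have Lam0 : 0 <= Lam by rewrite (le_trans _ Lam1).
have rx0 := dist_to_ge0 dm S0 x; have rx'0 := dist_to_ge0 dm S0 x'.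
have d0 := dge0 x x'.
have LamL : L <= Lam * L by rewrite ler_peMl.
have [far|near] := leP (rho x') (4 * d x x').
  rewrite (le_trans (ler_distD (g x) _ _))//.
  rewrite (le_trans (lerD (ext_near x) (ler_distD (g x') _ _)))//.
  have h0 := ext_near x'; rewrite distrC in h0.
  have h := lerD (gL x x') h0.
  rewrite (le_trans (lerD (lexx _) h))//.
  have h1 : L * rho x <= L * (4 * d x x') by rewrite ler_wpM2l// (le_trans le_xx').
  have h2 : L * rho x' <= L * (4 * d x x') by rewrite ler_wpM2l.
  have h3 : L * d x x' <= Lam * L * d x x' by rewrite ler_wpM2r.
  by have := mulr_ge0 L0 d0; lra.
have := dist_to_lipschitz dm S0 x' x.
have -> : d x' x = d x x' by case: dm.
move=> x'x.
have x0 : 0 < rho x by lra.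
have x'0 : 0 < rho x' by lra.
rewrite /ext !gt_eqF// distrC (le_trans (ler_distD (interp g (rho x) x') _ _))//.
have h1 : `|interp g (rho x') x' - interp g (rho x) x'| <= 56 * L * (rho x' - rho x).
  by apply: interp_scale => //; lra.
have h2 : `|interp g (rho x) x - interp g (rho x) x'| <= 46 * Lam * L * d x x'.
  by apply: interp_point => //; lra.
rewrite distrC in h2; rewrite (le_trans (lerD h1 h2))//.
have h3 : L * (rho x' - rho x) <= L * d x x' by rewrite ler_wpM2l//; lra.
have h4 : L * d x x' <= Lam * L * d x x' by rewrite ler_wpM2r.
have := mulr_ge0 (le_trans L0 LamL) d0.
by lra.
Qed.

End FixedFunction.

Lemma extension_from_means : (extension_constant d S X <= (200 * Lam)%:E)%E.
Proof.
have B0 : 0 <= 200 * Lam by rewrite mulr_ge0// (le_trans _ Lam1).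
(* Distances to [S] are meaningful only for nonempty [S]; for empty [S] the zero operator
   extends. *)
have [S0|/set0P S0] := eqVneq S set0.
  apply: (@extension_constant_le _ _ _ _ _ _ (fun _ _ => 0)) => //.
  - by move=> a f h x; rewrite scaler0 addr0.
  - by move=> f x; exfalso; rewrite -[False]/(set0 (val x)) -S0; exact: set_valP.
  - by move=> f L L0 _ x y; rewrite subrr normr0; apply: mulr_ge0 => //; exact: mulr_ge0.
have [g [glin gext gL]] := almost_extension X dm S0.
pose E f x := if dist_to d S x == 0 then g f x else interp (g f) (dist_to d S x) x.
apply: (@extension_constant_le _ _ _ _ _ _ E) => //.
- move=> a f h x; rewrite /E; case: ifPn => _; first exact: glin.
  have t0 := dyadic_scale_gt0 (dist_to d S x).
  have t20 : 0 < 2 * dyadic_scale (dist_to d S x) by rewrite mulr_gt0.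
  have -> : g (a *: f + h) = fun y => a *: g f y + g h y.
    by apply/funext => y; exact: glin.
  rewrite /interp !A_linear// !scalerDr !scalerA addrACA.
  by rewrite (mulrC a) (mulrC a).
- move=> f x; rewrite /E dist_to_mem ?eqxx//; exact: set_valP.
- move=> f L L0 fL x y; rewrite /E.
  exact: (ext_lipschitz L0 (gL f L L0 fL) S0).
Qed.

End ExtensionFromMeans.

(** * Averages over finitely many coordinates *)

Section FiniteWeights.
Context {R : realType} {B : choiceType}.
Implicit Type u : B -> R.

Definition weight_supp u : seq B := enum_fset (fset_set [set be | u be != 0]).

Record is_weight u : Prop := IsWeight {
  weight_finite : finite_set [set be | u be != 0] ;
  weight_ge0 : forall be, 0 <= u be ;
  weight_sum1 : \sum_(be <- weight_supp u) u be = 1 }.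

Lemma weight_suppP u be : is_weight u -> (be \in weight_supp u) = (u be != 0).
Proof.
move=> uw; rewrite /weight_supp in_fset_set; last exact: weight_finite.
by rewrite mem_setE.
Qed.

Lemma weight_supp_uniq u : uniq (weight_supp u).
Proof. exact: fset_uniq. Qed.

(** A longer index list adds only zero terms. This allows two weights with different supports to be
    summed over one common list. *)
Lemma weight_sum_widen (X : lmodType R) u (s : seq B) (g : B -> X) :
  is_weight u -> uniq s -> {subset weight_supp u <= s} ->
  \sum_(be <- weight_supp u) u be *: g be = \sum_(be <- s) u be *: g be.
Proof.
move=> uw us sub.
rewrite [RHS](bigID (mem (weight_supp u)))/= [X in _ = _ + X]big1_seq => [|be].
  rewrite addr0 -[RHS]big_filter; apply: perm_big; apply: uniq_perm.
  - exact: weight_supp_uniq.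
  - exact: filter_uniq.
  - move=> be; rewrite mem_filter; case: (boolP (be \in weight_supp u)) => //=.
    by move/sub => ->.
by rewrite weight_suppP// negbK => /andP[/eqP-> _]; rewrite scale0r.
Qed.

Lemma weight_sum1_widen u (s : seq B) :
  is_weight u -> uniq s -> {subset weight_supp u <= s} ->
  \sum_(be <- s) u be = 1.
Proof.
move=> uw us sub; rewrite -(weight_sum1 uw).
have sum1 t : \sum_(be <- t) u be *: (1 : R^o) = \sum_(be <- t) u be.
  by apply: eq_bigr => be _; exact: mulr1.
by rewrite -!sum1 (weight_sum_widen _ uw us sub).
Qed.

End FiniteWeights.

Section CoordinateAverages.
Context {R : realType} {I : eqType} (M : I -> Type) (B : I -> choiceType).
Variables (b : forall i, B i -> M i) (X : normedModType R).
Implicit Types (w : forall i, B i -> R) (l : seq I) (g : (forall i, M i) -> X).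

(** For duplicate-free [l], the integral of [g] against the product of the discrete laws [w i]
    pushed forward by [b], with the coordinates outside [l] frozen at [x]. *)
Fixpoint coord_avg w l g (x : forall i, M i) : X :=
  if l is i :: l' then
    \sum_(be <- weight_supp (w i)) w i be *: coord_avg w l' g (dfwith x i (b be))
  else g x.

Lemma coord_avg_linear w l a g h x :
  coord_avg w l (fun y => a *: g y + h y) x =
  a *: coord_avg w l g x + coord_avg w l h x.
Proof.
elim: l x => //= i l IH x; rewrite scaler_sumr -big_split/=.
by apply: eq_bigr => be _; rewrite IH scalerDr !scalerA mulrC.
Qed.

(** Each step is a convex combination, and a ball about [c] is convex. *)
Lemma coord_avg_mean w l g x c (r : R) : (forall i, is_weight (w i)) -> uniq l ->
  (forall y, (forall i, i \in l -> exists2 be, w i be != 0 & y i = b be) ->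
    (forall i, i \notin l -> y i = x i) -> `|g y - c| <= r) ->
  `|coord_avg w l g x - c| <= r.
Proof.
move=> ww; elim: l x => [|i l IH] x /=; first by move=> _; apply.
move=> /andP[il ul] gr.
have -> : c = \sum_(be <- weight_supp (w i)) w i be *: c.
  by rewrite -scaler_suml weight_sum1// scale1r.
rewrite -sumrB (le_trans (ler_norm_sum _ _ _))//.
have -> : r = \sum_(be <- weight_supp (w i)) w i be * r.
  by rewrite -mulr_suml weight_sum1// mul1r.
rewrite big_seq [leRHS]big_seq; apply: ler_sum => be.
rewrite weight_suppP// => be0.
rewrite -scalerBr normrZ ger0_norm ?weight_ge0// ler_wpM2l ?weight_ge0//.
apply: IH => // y yl ynl; apply: gr => j.
- rewrite inE; have [-> _|ji /=] := eqVneq j i; last exact: yl.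
  by exists be => //; rewrite ynl// dfwithin.
- rewrite inE negb_or => /andP[ji jl]; rewrite ynl// dfwithout//.
  by rewrite eq_sym.
Qed.

(** The variation of a product law is at most the sum of the variations of its factors: one law is
    exchanged at a time. Since [w i] and [w' i] have the same total mass, [c] may be subtracted, so
    only the oscillation [r] enters. *)
Lemma coord_avg_dist w w' l g x c (r : R) (e : I -> R) :
  (forall i, is_weight (w i)) -> (forall i, is_weight (w' i)) -> uniq l ->
  0 <= r ->
  (forall i (s : seq (B i)), uniq s ->
    \sum_(be <- s) `|w i be - w' i be| <= e i) ->
  (forall y, (forall i, i \in l ->
      exists2 be, (w i be != 0) || (w' i be != 0) & y i = b be) ->
    (forall i, i \notin l -> y i = x i) -> `|g y - c| <= r) ->
  `|coord_avg w l g x - coord_avg w' l g x| <= \sum_(i <- l) e i * r.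
Proof.
move=> ww ww' ul r0 we; elim: l x ul => [|i l IH] x /=.
  by rewrite big_nil subrr normr0.
move=> /andP[il ul] gr; rewrite big_cons.
pose s := undup (weight_supp (w i) ++ weight_supp (w' i)).
have us : uniq s by exact: undup_uniq.
rewrite !(weight_sum_widen (s := s))//; last 2 first.
- by move=> be; rewrite mem_undup mem_cat orbC => ->.
- by move=> be; rewrite mem_undup mem_cat => ->.
have gr_be be : be \in s -> forall y, (forall i, i \in l ->
      exists2 be, (w i be != 0) || (w' i be != 0) & y i = b be) ->
    (forall j, j \notin l -> y j = dfwith x i (b be) j) -> `|g y - c| <= r.
  rewrite mem_undup mem_cat !weight_suppP// => bes y yl ynl; apply: gr => j.
  - rewrite inE; have [-> _|ji /=] := eqVneq j i; last exact: yl.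
    by exists be => //; rewrite ynl// dfwithin.
  - rewrite inE negb_or => /andP[ji jl]; rewrite ynl// dfwithout//.
    by rewrite eq_sym.
pose a be := coord_avg w l g (dfwith x i (b be)).
pose a' be := coord_avg w' l g (dfwith x i (b be)).
have sum_c (v : B i -> R) : is_weight v -> {subset weight_supp v <= s} ->
    c = \sum_(be <- s) v be *: c.
  by move=> vw vs; rewrite -weight_sum_widen// -scaler_suml weight_sum1// scale1r.
(* Product rule: the first sum changes the inner laws and is left to the induction, the second
   changes the law of coordinate [i]. *)
have -> : \sum_(be <- s) w i be *: coord_avg w l g (dfwith x i (b be)) -
    \sum_(be <- s) w' i be *: coord_avg w' l g (dfwith x i (b be)) =
    \sum_(be <- s) w i be *: (a be - a' be) +
    \sum_(be <- s) (w i be - w' i be) *: (a' be - c).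
  rewrite [X in _ = _ + X](eq_bigr (fun be =>
    (w i be *: a' be - w' i be *: a' be) - (w i be *: c - w' i be *: c))); last first.
    by move=> be _; rewrite scalerBr !scalerBl.
  rewrite 3!sumrB -(sum_c (w i))// -?(sum_c (w' i))//; first last.
  - by move=> be; rewrite mem_undup mem_cat => ->.
  - by move=> be; rewrite mem_undup mem_cat orbC => ->.
  rewrite subrr subr0; under [X in _ = X + _]eq_bigr do rewrite scalerBr.
  by rewrite sumrB addrA subrK.
rewrite (le_trans (ler_normD _ _))// addrC lerD//.
  rewrite (le_trans (ler_norm_sum _ _ _))//.
  rewrite (@le_trans _ _ (\sum_(be <- s) `|w i be - w' i be| * r))//.
    rewrite big_seq [leRHS]big_seq; apply: ler_sum => be bes.
    rewrite normrZ ler_wpM2l//; apply: coord_avg_mean => // y yl ynl.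
    apply: (gr_be be bes) => // j /yl[be' be'0 ->].
    by exists be' => //; rewrite be'0 orbT.
  by rewrite -mulr_suml ler_wpM2r// we.
rewrite (le_trans (ler_norm_sum _ _ _))//.
set E := leRHS.
rewrite (@le_trans _ _ (\sum_(be <- s) w i be * E))//.
  rewrite big_seq [leRHS]big_seq; apply: ler_sum => be bes.
  rewrite normrZ ger0_norm ?weight_ge0// ler_wpM2l ?weight_ge0//.
  by apply: IH => //; exact: gr_be.
rewrite -mulr_suml (weight_sum1_widen (ww i) us) ?mul1r//.
by move=> be; rewrite mem_undup mem_cat => ->.
Qed.

End CoordinateAverages.

(** * The p-norm on finite families *)

Section PsumNorm.
Context {R : realType} {N : nat}.
Implicit Types (a b : 'I_N -> R) (p q : \bar R).

Lemma psum_norm_ge0 p a : 0 <= psum_norm p a.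
Proof.
case: p => [r| |] //=; first exact: powR_ge0.
exact: bigmax_ge_id.
Qed.

(** Normalizing by [s] removes the outer root, which leaves a sum of powers to which convexity and
    Young's inequality apply termwise. *)
Lemma psum_norm_leP (r : R) a (s : R) : 1 <= r -> (forall i, 0 <= a i) -> 0 < s ->
  (psum_norm r%:E a <= s) = (\sum_(i < N) (a i / s) `^ r <= 1).
Proof.
move=> r1 a0 s0; have r0 : 0 < r by exact: lt_le_trans r1.
have sum0 : 0 <= \sum_(i < N) a i `^ r by apply: sumr_ge0 => i _; exact: powR_ge0.
have -> : \sum_(i < N) (a i / s) `^ r = (\sum_(i < N) a i `^ r) / s `^ r.
  rewrite mulr_suml; apply: eq_bigr => i _.
  rewrite powRM ?invr_ge0//; last exact: ltW.
  by rewrite -powR_inv1 ?(ltW s0)// -powRrM mulN1r powRN.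
rewrite ler_pdivrMr ?powR_gt0// mul1r /=.
have e : s = (s `^ r) `^ r^-1 by rewrite -powRrM divff ?gt_eqF// powRr1// ltW.
rewrite {1}e; apply/idP/idP => [|h].
- apply: contraTT; rewrite -!ltNge => h.
  by apply: gt0_ltr_powR; rewrite ?invr_gt0// nnegrE ?powR_ge0.
- by apply: ge0_ler_powR; rewrite ?nnegrE ?powR_ge0// invr_ge0 ltW.
Qed.

Lemma psum_normy_leP a (s : R) : 0 <= s ->
  reflect (forall i, a i <= s) (psum_norm +oo%E a <= s).
Proof.
move=> s0 /=; apply: (iffP idP) => [h i|h]; last exact: bigmax_le.
by rewrite (le_trans _ h)//; exact: le_bigmax.
Qed.

Let p_cases p : (1 <= p)%E -> p = +oo%E \/ exists2 r : R, 1 <= r & p = r%:E.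
Proof. by case: p => [r| |]//; rewrite ?lee_fin => h; [right; exists r|left]. Qed.

Lemma ler_psum_norm p a b : (1 <= p)%E -> (forall i, 0 <= a i) ->
  (forall i, a i <= b i) -> psum_norm p a <= psum_norm p b.
Proof.
move=> /p_cases[->|[r r1 ->]] a0 ab /=; first exact: le_bigmax2.
apply: ge0_ler_powR; rewrite ?nnegrE ?invr_ge0 ?(le_trans _ r1)//.
- by apply: sumr_ge0 => i _; exact: powR_ge0.
- by apply: sumr_ge0 => i _; exact: powR_ge0.
apply: ler_sum => i _; apply: ge0_ler_powR; rewrite ?nnegrE//.
- exact: le_trans r1.
- exact: le_trans (ab i).
Qed.

Lemma psum_norm_coord p a i : (1 <= p)%E -> (forall i, 0 <= a i) ->
  a i <= psum_norm p a.
Proof.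
move=> /p_cases[->|[r r1 ->]] a0; first exact: le_bigmax.
have r0 : 0 < r by exact: lt_le_trans r1.
rewrite /= -{1}(powRr1 (a0 i)) -(divff (lt0r_neq0 r0)) powRrM.
apply: ge0_ler_powR; rewrite ?nnegrE ?invr_ge0 ?(ltW r0) ?powR_ge0//.
  by apply: sumr_ge0 => j _; exact: powR_ge0.
by rewrite (bigD1 i)//= lerDl sumr_ge0// => j _; exact: powR_ge0.
Qed.

Lemma psum_norm0 p : (1 <= p)%E -> psum_norm p (fun=> 0 : R) (N := N) = 0.
Proof.
move=> /p_cases[->|[r r1 ->]] /=; first by rewrite bigmax_eq_id.
have r0 : r != 0 by rewrite gt_eqF// (lt_le_trans _ r1).
by rewrite big1 ?powR0// ?invr_eq0// => i _; rewrite powR0.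
Qed.

(** Convexity of the [r]-th power: [(a i + b i) / (s + t)] is the convex combination of [a i / s]
    and [b i / t] with weight [s / (s + t)]. Positive [s] and [t] stand in for norms that may
    vanish. *)
Let psum_norm_unitD (r : R) a b (s t : R) : 1 <= r ->
  (forall i, 0 <= a i) -> (forall i, 0 <= b i) -> 0 < s -> 0 < t ->
  psum_norm r%:E a <= s -> psum_norm r%:E b <= t ->
  psum_norm r%:E (fun i => a i + b i) <= s + t.
Proof.
move=> r1 a0 b0 s0 t0; have st0 := addr_gt0 s0 t0.
have ab0 i : 0 <= a i + b i by rewrite addr_ge0.
move=> as1 bt1; rewrite (psum_norm_leP r1 a0 s0) in as1.
rewrite (psum_norm_leP r1 b0 t0) in bt1; rewrite (psum_norm_leP r1 ab0 st0).
pose c := s / (s + t).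
have c0 : 0 <= c by rewrite divr_ge0// ltW.
have c1 : c <= 1 by rewrite ler_pdivrMr// mul1r lerDl ltW.
have conv x y : 0 <= x -> 0 <= y ->
    (c * x + (1 - c) * y) `^ r <= c * x `^ r + (1 - c) * y `^ r.
  move=> x0 y0; apply: (convex_powR r1 (Itv01 c0 c1)) => //=.
    by rewrite mem_setE/= in_itv/= x0.
  by rewrite mem_setE/= in_itv/= y0.
rewrite (@le_trans _ _ (\sum_(i < N) (c * (a i / s) `^ r + (1 - c) * (b i / t) `^ r)))//.
  apply: ler_sum => i _.
  have -> : (a i + b i) / (s + t) = c * (a i / s) + (1 - c) * (b i / t).
    by rewrite /c; field; rewrite !gt_eqF.
  by apply: conv; rewrite divr_ge0// ltW.
rewrite big_split/= -!mulr_sumr.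
have := ler_wpM2l c0 as1; have c10 : 0 <= 1 - c by rewrite subr_ge0.
by have := ler_wpM2l c10 bt1; lra.
Qed.

Lemma psum_norm_triangle p a b : (1 <= p)%E ->
  (forall i, 0 <= a i) -> (forall i, 0 <= b i) ->
  psum_norm p (fun i => a i + b i) <= psum_norm p a + psum_norm p b.
Proof.
move=> /p_cases[->|[r r1 ->]] a0 b0.
  apply/psum_normy_leP => [|i]; first by rewrite addr_ge0 ?psum_norm_ge0.
  by apply: lerD; apply: psum_norm_coord; rewrite ?leey.
set A := psum_norm _ a; set B := psum_norm _ b.
apply/ler_addgt0Pl => e e0.
have -> : e + (A + B) = (A + e / 2) + (B + e / 2) by field.
have e2 : 0 < e / 2 by rewrite divr_gt0.
by apply: psum_norm_unitD; rewrite ?ltr_wpDl ?psum_norm_ge0// lerDl ltW.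
Qed.

Lemma conjugate_cases p q : (1 <= p)%E -> (p^-1 + q^-1 = 1)%E ->
  [\/ p = 1%E /\ q = +oo%E, p = +oo%E /\ q = 1%E |
   exists r s : R, [/\ 1 < r, 1 < s, r^-1 + s^-1 = 1, p = r%:E & q = s%:E]].
Proof.
move=> /p_cases[->|[r r1 ->]].
  by rewrite invey add0e => /eqP; rewrite inve_eq1 => /eqP ->; constructor 2.
have r0 : 0 < r by exact: lt_le_trans r1.
have rV1 : r^-1 <= 1 by rewrite invf_le1.
have rV0 : 0 < r^-1 by rewrite invr_gt0.
case: q => [s| |]; rewrite inver (gt_eqF r0) ?invey ?inveNy//.
- rewrite inver; case: ifPn => //= s0 [rs].
  have sV0 : 0 < s^-1.
    by rewrite lt_neqAle eq_sym invr_eq0 s0/= -(lerD2l r^-1) addr0 rs.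
  have sV1 : s^-1 < 1 by rewrite -rs ltrDr.
  constructor 3; exists r, s; split=> //.
  - by rewrite -invf_lt1// -rs ltrDl.
  - by rewrite -invf_lt1// -invr_gt0.
- rewrite adde0 => -[/(congr1 (@GRing.inv R))]; rewrite invrK invr1 => ->.
  by constructor 1.
Qed.

Lemma conjugate_ge1 p q : (1 <= p)%E -> (p^-1 + q^-1 = 1)%E -> (1 <= q)%E.
Proof.
move=> p1 /(conjugate_cases p1)[[_ ->]|[_ ->]|[r [s [_ s1 _ _ ->]]]].
- exact: leey.
- by [].
- by rewrite lee_fin ltW.
Qed.

Let le_mul_limit (x A B : R) : 0 <= A -> 0 <= B ->
  (forall s t, A < s -> B < t -> x <= s * t) -> x <= A * B.
Proof.
move=> A0 B0 h; apply/ler_addgt0Pr => e e0.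
(* The excess of [(A + d) * (B + d)] over [A * B] is [d * (A + B + d)], which is at most [e] for
   this [d]. *)
pose d := Num.min 1 (e / (A + B + 1)).
have AB : 0 < A + B + 1 by rewrite ltr_wpDl// addr_ge0.
have d0 : 0 < d by rewrite lt_min ltr01 divr_gt0.
have d1 : d <= 1 by rewrite ge_min lexx.
have d2 : d * (A + B + 1) <= e by rewrite -ler_pdivlMr// ge_min lexx orbT.
have := h (A + d) (B + d); rewrite !ltrDl => /(_ d0 d0) => /le_trans; apply.
by nra.
Qed.

(** Young's inequality, after division by numbers slightly above the norms, which may be 0; the two
    endpoint cases are direct. *)
Lemma hoelder_psum p q a b : (1 <= p)%E -> (p^-1 + q^-1 = 1)%E ->
  (forall i, 0 <= a i) -> (forall i, 0 <= b i) ->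
  \sum_(i < N) a i * b i <= psum_norm p a * psum_norm q b.
Proof.
have norm1 c : (forall i, 0 <= c i) -> psum_norm 1%:E c = \sum_(i < N) c i.
  move=> c0; rewrite /= invr1 powRr1; last first.
    by apply: sumr_ge0 => i _; exact: powR_ge0.
  by apply: eq_bigr => i _; rewrite powRr1.
move=> p1 /(conjugate_cases p1)[[-> ->]|[-> ->]|[r [s [r1 s1 rs -> ->]]]] a0 b0.
- rewrite norm1// mulr_suml; apply: ler_sum => i _.
  by rewrite ler_wpM2l//; apply: psum_norm_coord; rewrite ?leey.
- rewrite norm1// mulr_sumr; apply: ler_sum => i _.
  by rewrite ler_wpM2r//; apply: psum_norm_coord; rewrite ?leey.
apply: le_mul_limit; rewrite ?psum_norm_ge0// => u t au bt.
have u0 : 0 < u by rewrite (le_lt_trans _ au)// psum_norm_ge0.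
have t0 : 0 < t by rewrite (le_lt_trans _ bt)// psum_norm_ge0.
have au1 := ltW au; rewrite (psum_norm_leP (ltW r1) a0 u0) in au1.
have bt1 := ltW bt; rewrite (psum_norm_leP (ltW s1) b0 t0) in bt1.
have r0 : 0 < r by rewrite (lt_trans _ r1).
have s0 : 0 < s by rewrite (lt_trans _ s1).
suff : \sum_(i < N) (a i / u) * (b i / t) <= 1.
  have -> : \sum_(i < N) a i / u * (b i / t) = (\sum_(i < N) a i * b i) / (u * t).
    by rewrite mulr_suml; apply: eq_bigr => i _; rewrite mulrACA invfM.
  by rewrite ler_pdivrMr ?mulr_gt0// mul1r.
rewrite (@le_trans _ _ (\sum_(i < N) ((a i / u) `^ r / r + (b i / t) `^ s / s)))//.
  by apply: ler_sum => i _; apply: conjugate_powR; rewrite ?divr_ge0// ltW.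
rewrite big_split/= -!mulr_suml -rs lerD//.
- by rewrite ler_piMl// invr_ge0 ltW.
- by rewrite ler_piMl// invr_ge0 ltW.
Qed.

(** Explains radii proportional to [1/p]-th powers: their [p]-th powers add up to the original
    fractions. For [p = +oo] the exponent is 0 and every power equals 1. *)
Lemma psum_norm_root p a : (1 <= p)%E -> (forall i, 0 <= a i) ->
  \sum_(i < N) a i <= 1 -> psum_norm p (fun i => a i `^ fine p^-1) <= 1.
Proof.
move=> /p_cases[->|[r r1 ->]] a0 a1.
  by rewrite invey/=; apply: bigmax_le => // i _; rewrite powRr0.
have r0 : 0 < r by exact: lt_le_trans r1.
rewrite (psum_norm_leP r1 (fun i => powR_ge0 (a i) _) ltr01).
rewrite (le_trans _ a1)// ler_sum// => i _.
by rewrite divr1 -powRrM fine_invr mulVf ?gt_eqF// powRr1.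
Qed.

Lemma psum_normZ p a (t : R) : (1 <= p)%E -> (forall i, 0 <= a i) -> 0 <= t ->
  psum_norm p (fun i => t * a i) <= t * psum_norm p a.
Proof.
move=> p1 a0 t0; have [->|[r r1 pr]] := p_cases p1.
  apply/psum_normy_leP => [|i]; first by rewrite mulr_ge0 ?psum_norm_ge0.
  by rewrite ler_wpM2l//; apply: psum_norm_coord; rewrite ?leey.
have r0 : 0 < r by exact: lt_le_trans r1.
rewrite pr/= -{2}(powRr1 t0) -(divff (lt0r_neq0 r0)) powRrM -powRM ?powR_ge0//; last first.
  by apply: sumr_ge0 => i _; exact: powR_ge0.
by rewrite mulr_sumr; under eq_bigr do rewrite powRM//.
Qed.

End PsumNorm.

Lemma psum_dist_is_metric (R : realType) (N : nat) (M : 'I_N -> pmetricType R)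
    (p : \bar R) : (1 <= p)%E -> is_metric (psum_dist p (M := M)).
Proof.
move=> p1; split.
- move=> x; rewrite /psum_dist; under [X in psum_norm p X]eq_fun do rewrite mdistxx.
  exact: psum_norm0.
- move=> x y; rewrite /psum_dist; congr psum_norm.
  by apply/funext => i; rewrite metric_sym.
- move=> x y z; rewrite /psum_dist.
  apply: (le_trans _ (psum_norm_triangle p1 _ _)) => // [|i|i]; try exact: mdist_ge0.
  by apply: ler_psum_norm => // i; [exact: mdist_ge0|exact: metric_triangle].
- move=> x y xy; apply: functional_extensionality_dep => i.
  apply: mdist_positivity; apply/eqP; rewrite eq_le mdist_ge0 andbT -xy.
  apply: (psum_norm_coord (a := fun i => mdist (x i) (y i))) => // j.
  exact: mdist_ge0.
Qed.

(** * Finitely additive radial averages *)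

Lemma ultra_fmap (T V : Type) (f : T -> V) (F : set_system T) :
  UltraFilter F -> UltraFilter (f @ F).
Proof.
move=> UF; split; first exact: fmap_proper_filter.
move=> G GF FG; apply/seteqP; split; last exact: FG.
move=> A GA; have [//|FA] := in_ultra_setVsetC (f @^-1` A) UF.
have /FG GCA : (f @ F) (~` A) by [].
by have /filter_ex[? []] : G (A `&` ~` A) by exact: filterI.
Qed.

Section GeneralizedLimit.
Context {R : realType}.

(** The limit along an ultrafilter refining the cofinite filter. It exists for bounded sequences
    because segments are compact, and it respects inequalities that hold eventually. *)
Lemma generalized_limit : exists L : (nat -> R) -> R,
  let bounded x := exists k : R, forall n, `|x n| <= k in
  [/\ forall x y, bounded x -> bounded y -> L (fun n => x n + y n) = L x + L y,
      forall c x, bounded x -> L (fun n => c * x n) = c * L x,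
      forall x y, bounded x -> bounded y ->
        (\forall n \near \oo, x n <= y n) -> L x <= L y &
      forall c, L (fun=> c) = c].
Proof.
have [U [UU ooU]] := ultraFilterLemma eventually_filter.
exists (fun x => lim (x @ U)) => bounded.
have cvgU x : bounded x -> cvg (x @ U).
  move=> [k xk]; have := @segment_compact R (- k) k.
  rewrite compact_ultra => /(_ (x @ U) _) cpt.
  have [|l [_ xl]] := cpt (ultra_fmap _ UU) _; last by apply/cvg_ex; exists l.
  by apply: (@filterE _ U) => n /=; rewrite in_itv/= -ler_norml.
split.
- by move=> x y /cvgU x1 /cvgU y1; exact: limD.
- by move=> c x /cvgU x1; apply/cvg_lim => //; exact: cvgMr.
- by move=> x y /cvgU x1 /cvgU y1 /ooU xy; exact: ler_lim.
- by move=> c; exact: lim_cst.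
Qed.

(** Each further unit of shift adds a telescoping sum [g (n + k) - g k], at most the total
    increase. *)
Lemma nondecreasing_sum_shift (g : nat -> R) (n k : nat) :
  {homo g : i j / (i <= j)%N >-> i <= j} ->
  \sum_(j < n) (g (j + k)%N - g j) <= k%:R * (g (n + k)%N - g 0%N).
Proof.
move=> gm; elim: k => [|k IH].
  by rewrite mul0r big1// => i _; rewrite addn0 subrr.
have -> : \sum_(j < n) (g (j + k.+1)%N - g j) =
    \sum_(j < n) (g (j + k)%N - g j) + (g (n + k)%N - g k).
  rewrite -[k in g k]add0n -(@telescope_sumr _ 0 n (fun j => g (j + k)%N))//.
  rewrite big_mkord -big_split/=; apply: eq_bigr => j _.
  by rewrite addSnnS addrC addrA subrK.
have h1 : g 0 <= g k by exact: gm.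
have h2 : g (n + k)%N <= g (n + k.+1)%N by apply: gm; rewrite leq_add2l.
have h3 : k%:R * (g (n + k)%N - g 0) <= k%:R * (g (n + k.+1)%N - g 0).
  by rewrite ler_wpM2l// lerB.
rewrite -natr1 mulrDl mul1r.
by move: IH h3; set x := \sum_(_ < _) _; set y := _ * _; set z := _ * _; lra.
Qed.

Section RadialMean.
Variable a : R.
Hypothesis a0 : 0 < a.

Let bounded (f : R -> R) := exists k : R, forall r, a <= r <= 2 * a -> `|f r| <= k.

(* A finitely additive substitute for the normalized integral over [a, 2a]:
   no measurability is needed, and shifts of monotone functions are controlled
   by telescoping Riemann sums. *)
Lemma radial_mean : exists J : (R -> R) -> R,
  [/\ forall f g, bounded f -> bounded g -> J (fun r => f r + g r) = J f + J g,
      forall c f, bounded f -> J (fun r => c * f r) = c * J f,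
      forall f g, bounded f -> bounded g ->
        (forall r, a <= r <= 2 * a -> f r <= g r) -> J f <= J g,
      forall c, J (fun=> c) = c &
      forall G d, 0 < d -> d <= a / 4 ->
        (forall r s, a / 2 <= r -> r <= s -> s <= 4 * a -> G r <= G s) ->
        J (fun r => G (r + d) - G (r - d)) <= 4 * d / a * (G (4 * a) - G (a / 2))].
Proof.
have [L [LD LZ Lle Lc]] := generalized_limit.
pose node (n j : nat) : R := a + j%:R * (a / n.+1%:R).
pose avg f n : R := (n.+1%:R)^-1 * \sum_(j < n.+1) f (node n j).
have node_itv n (j : 'I_n.+1) : a <= node n j <= 2 * a.
  rewrite /node lerDl mulr_ge0 ?divr_ge0 ?(ltW a0)//= mulrDl mul1r lerD2l.
  rewrite mulrCA ler_piMr ?(ltW a0)// ler_pdivrMr// mul1r ler_nat.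
  exact: ltnW.
have avg_cst (c : R) n : avg (fun=> c) n = c.
  by rewrite /avg sumr_const card_ord -[X in _ * X]mulr_natl mulKf// pnatr_eq0.
have avg_le f g n : (forall r, a <= r <= 2 * a -> f r <= g r) -> avg f n <= avg g n.
  by move=> fg; rewrite ler_wpM2l ?invr_ge0//; apply: ler_sum => j _; exact: fg.
have avg_bounded f : bounded f -> exists k : R, forall n, `|avg f n| <= k.
  move=> [k fk]; exists k => n; rewrite ler_norml.
  rewrite -[leLHS](avg_cst (- k) n) -[X in _ && (_ <= X)](avg_cst k n).
  by apply/andP; split; apply: avg_le => r /fk; rewrite ler_norml => /andP[].
exists (fun f => L (avg f)); split.
- move=> f g /avg_bounded fb /avg_bounded gb; rewrite -LD//; congr L.
  by apply/funext => n; rewrite /avg big_split/= mulrDr.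
- move=> c f /avg_bounded fb; rewrite -LZ//; congr L.
  by apply/funext => n; rewrite /avg -mulr_sumr mulrCA.
- move=> f g /avg_bounded fb /avg_bounded gb fg; apply: Lle => //.
  by apply: nearW => n; exact: avg_le.
- by move=> c; rewrite -[RHS]Lc; congr L; apply/funext => n; exact: avg_cst.
move=> G d d0 da Gm; set E := _ * _.
rewrite -(Lc E); apply: Lle; [|by exists (`|E|)|].
  apply: avg_bounded; exists (G (4 * a) - G (a / 2)) => r /andP[r1 r2].
  have h1 : G (r - d) <= G (r + d) by apply: Gm; lra.
  rewrite ger0_norm ?subr_ge0// lerB//; apply: Gm; lra.
have ad0 : 0 < d / a by rewrite divr_gt0.
have [n0 _ n0P] := near_infty_natSinv_lt (PosNum ad0).
exists n0 => // n /= /n0P/=; set N : R := n.+1%:R => nP.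
have N0 : 0 < N by rewrite ltr0n.
pose e := a / N; have e0 : 0 < e by rewrite divr_gt0.
have ed : e < d by rewrite /e mulrC -ltr_pdivlMr.
(* Shifting by [k] nodes covers the step from [r - d] to [r + d], and the mesh [e < d] keeps it
   below [3 * d]. *)
have [k [k1 k2]] : exists k : nat, 2 * d <= k%:R * e /\ k%:R * e <= 3 * d.
  exists (Num.trunc (2 * d / e)).+1.
  have /truncn_itv/andP[] : 0 <= 2 * d / e by rewrite divr_ge0 ?(ltW e0)// mulr_ge0// ltW.
  rewrite ler_pdivlMr// ltr_pdivrMr// => t1 t2; split; first exact: ltW.
  by rewrite -natr1 mulrDl mul1r; lra.
(* [G] is monotone only up to [4 * a]; truncation there makes [g] monotone on all indices and is
   inactive at the nodes used. *)
pose g (j : nat) := G (Num.min (a + j%:R * e - d) (4 * a)).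
have gm : {homo g : i j / (i <= j)%N >-> i <= j}.
  move=> i j ij; apply: Gm.
  - by rewrite le_min; apply/andP; split; [have := mulr_ge0 (ler0n R i) (ltW e0)|]; lra.
  - rewrite le_min !ge_min lexx orbT andbT; apply/orP; left.
    by rewrite lerB// lerD2l ler_wpM2r ?(ltW e0)// ler_nat.
  - by rewrite ge_min lexx orbT.
have gE (j : nat) : j%:R * e <= 2 * a -> g j = G (a + j%:R * e - d).
  by move=> ja; rewrite /g min_l//; lra.
have Ne : N * e = a by rewrite /e mulrC divfK// gt_eqF.
have NK : (n.+1 + k)%:R * e <= a + 3 * d by rewrite natrD mulrDl -/N Ne lerD2l.
have G0 : 0 <= G (4 * a) - G (a / 2) by rewrite subr_ge0; apply: Gm; lra.
apply: (@le_trans _ _ (N^-1 * (k%:R * (G (4 * a) - G (a / 2))))); last first.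
  rewrite mulrA ler_wpM2r// ler_pdivrMl//.
  have -> : N * (4 * d / a) = 4 * d / e by rewrite /e; field; rewrite !gt_eqF.
  by rewrite ler_pdivlMr//; lra.
rewrite /avg -/N ler_wpM2l ?invr_ge0 ?(ltW N0)//.
apply: (@le_trans _ _ (\sum_(j < n.+1) (g (j + k)%N - g j))).
  apply: ler_sum => j _.
  have jN : j%:R * e <= a.
    by rewrite -Ne ler_wpM2r ?(ltW e0)// ler_nat ltnW.
  have je0 : 0 <= j%:R * e by rewrite mulr_ge0// ltW.
  rewrite !gE; [|lra|by rewrite natrD mulrDl; lra].
  rewrite /node -/N -/e natrD mulrDl lerD2r; apply: Gm; lra.
rewrite (le_trans (nondecreasing_sum_shift _ _ gm))// ler_wpM2l//.
rewrite lerB//; first by apply: Gm; rewrite ?ge_min ?lexx ?orbT// le_min; apply/andP;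
  split; [have := mulr_ge0 (ler0n R (n.+1 + k)) (ltW e0)|]; lra.
by rewrite gE ?mul0r ?addr0; [apply: Gm|]; lra.
Qed.

End RadialMean.
End GeneralizedLimit.

(** * Masses of balls *)

Section BallMasses.
Context {R : realType} {M : pmetricType R}.
Variable mu : M -> {measure set (borel M) -> \bar R}.
Hypothesis mu_ph : pointwise_homogeneous mu.
Implicit Types (m : M) (r s : R) (A B : set (borel M)).

Lemma subset_ballD m m' r : ball m r `<=` ball m' (r + mdist m m').
Proof.
move=> x; rewrite !ballEmdist/= => mx.
by rewrite (le_lt_trans (metric_triangle _ m _))// metric_sym addrC ltrD2r.
Qed.

Lemma subset_ball_le m r s : r <= s -> ball m r `<=` ball m s.
Proof. by move=> rs x; rewrite !ballEmdist/= => /lt_le_trans; apply. Qed.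

Lemma measurable_ball m r : measurable (ball m r : set (borel M)).
Proof.
apply: sub_sigma_algebra; rewrite /= openE => x; rewrite ballEmdist/= => mx.
apply/nbhs_ballP; exists (r - mdist m x); first by rewrite /= subr_gt0.
move=> y; rewrite ballEmdist/= => xy.
by rewrite (le_lt_trans (metric_triangle _ x _))// -ltrBrDl.
Qed.

(** The measures may be infinite on the whole space. On these sets they are finite, so that [mass]
    does not hide an infinite value behind the default of [fine]. *)
Definition bounded_meas A := measurable A /\ exists m r, A `<=` ball m r.

Definition mass m A : R := fine (mu m A).

Definition ball_mass m r : R := mass m (ball m r).

Lemma bounded_ball m r : bounded_meas (ball m r).
Proof. by split; [exact: measurable_ball|exists m, r]. Qed.

Lemma bounded_measS A B : measurable A -> A `<=` B -> bounded_meas B -> bounded_meas A.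
Proof.
move=> mA AB [mB [m [r Br]]]; split => //; exists m, r.
exact: subset_trans Br.
Qed.

Lemma bounded_measI A m r : measurable A -> bounded_meas (A `&` ball m r).
Proof.
move=> mA; apply: bounded_measS (bounded_ball m r); last exact: subIsetr.
by apply: measurableI => //; exact: measurable_ball.
Qed.

Lemma mass_fin m A : bounded_meas A -> mu m A \is a fin_num.
Proof.
move=> [mA [m0 [r Ar]]]; rewrite ge0_fin_numE//.
(* The radius [r] may be negative, while finiteness is given for positive radii. *)
pose s := Num.max 1 (r + mdist m0 m).
have s0 : 0 < s by rewrite lt_max ltr01.
have [[/(_ m s s0)/andP[_ fin] _] _] := mu_ph.
apply: le_lt_trans fin; apply: le_measure; [exact: mem_set| |].
  by apply: mem_set; exact: measurable_ball.
apply: (subset_trans Ar); apply: (subset_trans (@subset_ballD m0 m r)).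
by apply: subset_ball_le; rewrite le_max lexx orbT.
Qed.

Lemma massE m A : bounded_meas A -> (mass m A)%:E = mu m A.
Proof. by move=> bA; rewrite fineK// mass_fin. Qed.

Lemma mass_ge0 m A : 0 <= mass m A.
Proof. exact: fine_ge0. Qed.

Lemma le_mass m A B : measurable A -> bounded_meas B -> A `<=` B ->
  mass m A <= mass m B.
Proof.
move=> mA bB AB; rewrite -lee_fin !massE//; last exact: bounded_measS bB.
by apply: le_measure => //; apply: mem_set => //; case: bB.
Qed.

Lemma mass_sum m n (F : 'I_n -> set (borel M)) A : (forall i, measurable (F i)) ->
  trivIset setT F -> \bigcup_i F i = A -> bounded_meas A ->
  \sum_(i < n) mass m (F i) = mass m A.
Proof.
move=> mF tF FA bA; rewrite sum_fine; last first.
  move=> i _; apply: mass_fin; apply: bounded_measS bA => //.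
  by rewrite -FA => x Fx; exists i.
have bigE : \big[setU/set0]_(i < n) F i = A.
  rewrite -FA -bigcup_seq; apply: eq_bigcupl; split=> i _ //=.
  exact: mem_index_enum.
by rewrite -measure_semi_additive_ord// bigE//; case: bA.
Qed.

Lemma ball_mass_gt0 m r : 0 < r -> 0 < ball_mass m r.
Proof.
move=> r0; rewrite -lte_fin massE; last exact: bounded_ball.
by have [[/(_ m r r0)/andP[]]] := mu_ph.
Qed.

Lemma le_ball_mass m r s : r <= s -> ball_mass m r <= ball_mass m s.
Proof.
move=> rs; apply: le_mass; first exact: measurable_ball.
  exact: bounded_ball.
exact: subset_ball_le.
Qed.

Lemma ball_mass_double m r : 0 < r ->
  ball_mass m (2 * r) <= doubling_constant mu * ball_mass m r.
Proof.
move=> r0; have [[_ Dfin] _] := mu_ph.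
have v0 := ball_mass_gt0 m r0.
rewrite -ler_pdivrMr//.
have le_sup : ((ball_mass m (2 * r) / ball_mass m r)%:E <= doubling_sup mu)%E.
  apply: ereal_sup_ubound; exists m, r; split => //.
  by rewrite EFinM -!massE ?inver ?gt_eqF//; exact: bounded_ball.
rewrite -lee_fin (le_trans le_sup)// /doubling_constant fineK//.
by rewrite fin_numElt Dfin andbT (lt_le_trans _ le_sup)// ltNyr.
Qed.

Lemma doubling_constant_ge1 : 1 <= doubling_constant mu.
Proof.
have := ball_mass_double point ltr01; have := ball_mass_gt0 point ltr01.
have : ball_mass point 1 <= ball_mass point (2 * 1) by apply: le_ball_mass; lra.
by nra.
Qed.

Lemma consistency_constant_ge0 : 0 <= consistency_constant mu.
Proof.
have [[C CC]|ne] := pselect (exists C, 0 <= C /\ consistent_with mu C).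
  rewrite /consistency_constant; apply: lb_le_inf; first by exists C.
  by move=> x [x0 _].
rewrite /consistency_constant (_ : [set _ | _] = set0) ?inf0//.
by rewrite -subset0 => C CC; apply: ne; exists C.
Qed.

(** Every admissible constant bounds the sum by a multiple of the same quantity [y]; dividing by
    [y > 0] passes the bound to the infimum, and for [y = 0] any admissible constant already gives
    0. *)
Lemma consistency_partition m1 m2 m r n (F : 'I_n -> set (borel M)) :
  0 < r -> m = m1 \/ m = m2 ->
  (forall i, measurable (F i)) -> trivIset setT F -> \bigcup_i F i = setT ->
  \sum_(i < n) `|mass m1 (F i `&` ball m r) - mass m2 (F i `&` ball m r)| <=
  consistency_constant mu * (ball_mass m r / r * mdist m1 m2).
Proof.
move=> r0 mm mF tF FT; set x := \sum_(i < n) _; set y := _ * mdist _ _.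
have v0 := ball_mass_gt0 m r0.
have y0 : 0 <= y by rewrite mulr_ge0 ?mdist_ge0// divr_ge0// ltW.
have xC C : consistent_with mu C -> x <= C * y.
  move=> /(_ m1 m2 r r0 m mm); rewrite -massE; last exact: bounded_ball.
  rewrite inver gt_eqF// -!EFinM => tv; rewrite -lee_fin /y !mulrA.
  apply: le_trans tv; rewrite /total_variation.
  apply: ereal_sup_ubound; exists n, (fun i => F i `&` ball m r); split.
  - by move=> i; apply: measurableI => //; exact: measurable_ball.
  - exact: trivIset_setIr.
  - by rewrite -setI_bigcupl FT setTI.
  - rewrite -sumEFin; apply: eq_bigr => i _.
    by rewrite -!massE ?EFinB//; exact: bounded_measI.
have [_ [C0 C0P]] := mu_ph.
(* The constant in [pointwise_homogeneous] carries no sign, whereas the infimum ranges over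
   nonnegative ones. *)
have [C1 [C10 C1P]] : exists C, 0 <= C /\ consistent_with mu C.
  exists (Num.max 0 C0); split; first by rewrite le_max lexx.
  move=> n1 n2 s s0 n' nn'; apply: (le_trans (C0P n1 n2 s s0 n' nn')).
  rewrite -massE; last exact: bounded_ball.
  rewrite inver gt_eqF// -!EFinM lee_fin !ler_wpM2r ?mdist_ge0 ?mass_ge0//.
    by rewrite invr_ge0 ltW.
  by rewrite le_max lexx orbT.
have [y_eq0|/eqP yn0] := eqVneq y 0.
  by rewrite y_eq0 mulr0; have := xC C1 C1P; rewrite y_eq0 mulr0.
have {yn0}y0 : 0 < y by rewrite lt_neqAle eq_sym y0 andbT; apply/eqP.
rewrite -ler_pdivrMr//; apply: lb_le_inf; first by exists C1.
by move=> C [_ CP]; rewrite ler_pdivrMr//; exact: xC.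
Qed.

End BallMasses.

(** Passing from [a / V] to [e / V] changes the measure and from [e / V] to [e / V2] the
    normalization, each at cost [delta]. Then [e / V2] and [a' / V1] have total 1 and both dominate
    [l / Vo], so they differ by at most [2 * (1 - Vi / Vo)], which the logarithm bounds. *)
Lemma sum_ratio_dist (R : realType) (n : nat) (a e a' l : 'I_n -> R)
    (V V1 V2 Vi Vo delta : R) :
  0 < V -> 0 < V1 -> 0 < V2 -> 0 < Vi ->
  \sum_(i < n) a i = V -> \sum_(i < n) e i = V2 -> \sum_(i < n) a' i = V1 ->
  \sum_(i < n) l i = Vi -> V1 <= Vo -> V2 <= Vo ->
  (forall i, 0 <= l i) -> (forall i, l i <= e i) -> (forall i, l i <= a' i) ->
  \sum_(i < n) `|a i - e i| <= delta * V ->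
  \sum_(i < n) `|a i / V - a' i / V1| <= 2 * delta + 2 * (ln Vo - ln Vi).
Proof.
move=> V0 V10 V20 Vi0 aV eV a'V lV V1o V2o l0 le la' ae.
have Vo0 : 0 < Vo by exact: lt_le_trans V1o.
have e0 i : 0 <= e i by exact: le_trans (le i).
have a'0 i : 0 <= a' i by exact: le_trans (la' i).
have VV : `|V - V2| <= delta * V.
  by rewrite -{1}aV -eV -sumrB (le_trans _ ae)// ler_norm_sum.
have step1 : \sum_(i < n) `|a i / V - e i / V| <= delta.
  under eq_bigr do rewrite -mulrBl normrM (gtr0_norm (_ : 0 < V^-1)) ?invr_gt0//.
  by rewrite -mulr_suml ler_pdivrMr.
have step2 : \sum_(i < n) `|e i / V - e i / V2| <= delta.
  under eq_bigr do rewrite -mulrBr normrM ger0_norm//.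
  rewrite -mulr_suml eV.
  have -> : V^-1 - V2^-1 = (V2 - V) / (V * V2) by field; rewrite !gt_eqF.
  rewrite normrM distrC (gtr0_norm (_ : 0 < (V * V2)^-1)) ?invr_gt0 ?mulr_gt0//.
  have -> : V2 * (`|V - V2| / (V * V2)) = `|V - V2| / V by field; rewrite !gt_eqF.
  by rewrite ler_pdivrMr.
have step3 : \sum_(i < n) `|e i / V2 - a' i / V1| <= 2 * (ln Vo - ln Vi).
  apply: (@le_trans _ _ (\sum_(i < n) (e i / V2 + a' i / V1 - 2 * (l i / Vo)))).
    apply: ler_sum => i _.
    have h1 : l i / Vo <= e i / V2.
      apply: ler_pM => //; first by rewrite invr_ge0 ltW.
      by rewrite lef_pV2.
    have h2 : l i / Vo <= a' i / V1.
      apply: ler_pM => //; first by rewrite invr_ge0 ltW.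
      by rewrite lef_pV2.
    by rewrite ler_norml; apply/andP; split; lra.
  rewrite sumrB big_split/= -mulr_sumr -!mulr_suml eV a'V lV !divff ?gt_eqF//.
  have := ln_sublinear (divr_gt0 Vi0 Vo0).
  have lnle : ln (Vi / Vo) <= Vi / Vo - 1.
    have := @expR_ge1Dx _ (ln (Vi / Vo)); rewrite lnK ?posrE ?divr_gt0//; lra.
  by move=> _; move: lnle; rewrite ln_div ?posrE//; lra.
apply: (@le_trans _ _ (\sum_(i < n) (`|a i / V - e i / V| +
    (`|e i / V - e i / V2| + `|e i / V2 - a' i / V1|)))).
  apply: ler_sum => i _; rewrite (le_trans (ler_distD (e i / V) _ _))// lerD2l.
  exact: ler_distD.
by rewrite !big_split/=; lra.
Qed.

Section BallRatios.
Context {R : realType} {M : pmetricType R}.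
Variable mu : M -> {measure set (borel M) -> \bar R}.
Hypothesis mu_ph : pointwise_homogeneous mu.

(** The intermediate object is [mu m2] on [ball m1 r], a ball squeezed between the balls about [m2]
    of radii [r - d] and [r + d]. *)
Lemma ball_ratio_dist (m1 m2 : M) (r : R) n (F : 'I_n -> set (borel M)) :
  mdist m1 m2 < r ->
  (forall i, measurable (F i)) -> trivIset setT F -> \bigcup_i F i = setT ->
  \sum_(i < n) `|mass mu m1 (F i `&` ball m1 r) / ball_mass mu m1 r -
                 mass mu m2 (F i `&` ball m2 r) / ball_mass mu m2 r| <=
  2 * (consistency_constant mu * (mdist m1 m2 / r)) +
  2 * (ln (ball_mass mu m2 (r + mdist m1 m2)) - ln (ball_mass mu m2 (r - mdist m1 m2))).
Proof.
set d := mdist m1 m2 => dr mF tF FT.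
have r0 : 0 < r by rewrite (le_lt_trans _ dr)// mdist_ge0.
have sum_ball m m' s :
    \sum_(i < n) mass mu m (F i `&` ball m' s) = mass mu m (ball m' s).
  apply: (mass_sum mu_ph) => //.
  - by move=> i; apply: measurableI => //; exact: measurable_ball.
  - exact: trivIset_setIr.
  - by rewrite -setI_bigcupl FT setTI.
  - exact: bounded_ball.
have sub1 : ball m2 (r - d) `<=` ball m1 r.
  by have := @subset_ballD _ _ m2 m1 (r - d); rewrite metric_sym subrK.
have sub2 : ball m1 r `<=` ball m2 (r + d) by exact: subset_ballD.
have mass_cap m m' m'' s t i : ball m' s `<=` ball m'' t ->
    mass mu m (F i `&` ball m' s) <= mass mu m (F i `&` ball m'' t).
  move=> st; apply: (le_mass mu_ph).
  - by apply: measurableI => //; exact: measurable_ball.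
  - exact: bounded_measI.
  - exact: setIS.
have d0 : 0 <= d := mdist_ge0 m1 m2.
have inner0 : 0 < ball_mass mu m2 (r - d) by rewrite ball_mass_gt0// subr_gt0.
apply: (sum_ratio_dist (V2 := mass mu m2 (ball m1 r))
  (e := fun i => mass mu m2 (F i `&` ball m1 r))
  (l := fun i => mass mu m2 (F i `&` ball m2 (r - d)))).
- exact: ball_mass_gt0.
- exact: ball_mass_gt0.
- apply: lt_le_trans inner0 _; apply: (le_mass mu_ph) => //.
  + exact: measurable_ball.
  + exact: bounded_ball.
- exact: inner0.
- exact: sum_ball.
- exact: sum_ball.
- exact: sum_ball.
- exact: sum_ball.
- by apply: le_ball_mass => //; rewrite lerDl.
- apply: (le_mass mu_ph) => //; first exact: measurable_ball.
  exact: bounded_ball.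
- by move=> i; exact: mass_ge0.
- by move=> i; exact: mass_cap.
- by move=> i; apply: mass_cap; apply: subset_ball_le; rewrite gerBl.
- have := consistency_partition mu_ph (m2 := m2) r0 (or_introl (erefl m1)) mF tF FT.
  move=> /le_trans; apply.
  by rewrite le_eqVlt; apply/orP; left; apply/eqP; rewrite /d; ring.
Qed.

End BallRatios.

(** * Maximal families of mutually singular measures *)

(** Exhaustion: the union of a sequence of sets nearly attaining the supremum of [nu] over [P]
    attains it, and a member of positive measure outside the union would exceed it. *)
Lemma sigma_ideal_maximal d (T : measurableType d) (R : realType)
    (nu : {measure set T -> \bar R}) (P : set (set T)) :
  (nu setT < +oo)%E -> (forall A, P A -> measurable A) -> P !=set0 ->
  (forall F : nat -> set T, (forall n, P (F n)) -> P (\bigcup_n F n)) ->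
  exists2 Z, P Z & forall Z', P Z' -> nu (Z' `\` Z) = 0%E.
Proof.
move=> nufin Pm [A0 PA0] Pcup.
have nu_fin A : P A -> nu A \is a fin_num.
  move=> PA; rewrite ge0_fin_numE//; apply: le_lt_trans nufin.
  by apply: le_measure => //; apply: mem_set => //; exact: Pm.
pose s := ereal_sup [set nu A | A in P].
have s_ub A : P A -> (nu A <= s)%E by move=> PA; apply: ereal_sup_ubound; exists A.
have s_fin : s \is a fin_num.
  rewrite ge0_fin_numE; last by apply: le_trans (s_ub _ PA0).
  apply: le_lt_trans nufin; apply: ge_ereal_sup => _ [A PA <-].
  by apply: le_measure => //; apply: mem_set => //; exact: Pm.
have /choice[A AP] (n : nat) : exists A, P A /\ (s - n.+1%:R^-1%:E < nu A)%E.
  have n0 : 0 < n.+1%:R^-1 :> R by rewrite invr_gt0.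
  have [_ [A PA <-] sA] := ub_ereal_sup_adherent n0 s_fin.
  by exists A.
have PZ : P (\bigcup_n A n) by apply: Pcup => n; exact: (AP n).1.
have nuZ : nu (\bigcup_n A n) = s.
  apply/eqP; rewrite eq_le s_ub//= -(fineK (nu_fin _ PZ)) -(fineK s_fin) lee_fin.
  apply/ler_addgt0Pr => e e0.
  have [N _ /(_ N (leqnn N))/= Ne] := near_infty_natSinv_lt (PosNum e0).
  have := (AP N).2; rewrite -{1}(fineK s_fin) -EFinB => /ltW /le_trans.
  move=> /(_ (nu (\bigcup_n A n))); rewrite -(fineK (nu_fin _ PZ)) lee_fin lerBlDr.
  move=> h; rewrite (le_trans (h _))//; last by rewrite lerD2l ltW.
  rewrite fineK ?nu_fin//; apply: le_measure.
  - by apply: mem_set; apply: Pm; exact: (AP N).1.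
  - by apply: mem_set; exact: Pm.
  - by move=> x Ax; exists N.
exists (\bigcup_n A n) => // Z' PZ'.
set Z := \bigcup_n A n in PZ nuZ *.
have PU : P (Z `|` Z').
  pose F n := if n is 0%N then Z else Z'.
  have -> : Z `|` Z' = \bigcup_n F n.
    apply/seteqP; split=> [x [xZ|xZ]|x [[|n] _ /= xF]]; [by exists 0%N|by exists 1%N|..].
    - by left.
    - by right.
  by apply: Pcup => -[].
have ZZ' : Z `|` Z' = Z `|` (Z' `\` Z).
  apply/seteqP; split=> [x [xZ|xZ']|x [xZ|[xZ' _]]]; [by left| |by left|by right].
  by have [xZ|xZ] := pselect (Z x); [left|right].
rewrite ZZ' in PU; have := s_ub _ PU; rewrite measureU//; first last.
- by rewrite setDE setICA setICr setI0.
- by apply: measurableD; exact: Pm.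
- exact: Pm.
rewrite -[leLHS]/(nu Z + nu (Z' `\` Z))%E nuZ -[leRHS]adde0 leeD2lE// => h.
by apply/eqP; rewrite eq_le h measure_ge0.
Qed.

Section Atomization.
Context d (T : measurableType d) (R : realType) (M : choiceType).
Variable nu : M -> {measure set T -> \bar R}.
Hypothesis nu_fin : forall m, (nu m setT < +oo)%E.

Local Notation cell := (M * set T)%type.
Implicit Types (be ga : cell) (m : M).

(* A cell [(m, E)] stands for the measure [nu m] restricted to [E]. *)
Definition cell_null be (Z : set T) := measurable Z /\ nu be.1 (be.2 `&` Z) = 0%E.

Definition cells_singular be ga :=
  exists W, cell_null be W /\ cell_null ga (~` W).

Lemma cells_singularC be ga : cells_singular be ga -> cells_singular ga be.
Proof. by move=> [W [beW gaW]]; exists (~` W); rewrite setCK. Qed.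

Lemma cell_null_bigcup be (F : nat -> set T) : measurable be.2 ->
  (forall n, cell_null be (F n)) -> cell_null be (\bigcup_n F n).
Proof.
move=> mbe bF; split; first by apply: bigcupT_measurable => n; exact: (bF n).1.
apply/negligibleP; first by apply: measurableI => //; apply: bigcupT_measurable => n; exact: (bF n).1.
rewrite setI_bigcupr; apply: negligible_bigcup => n; apply/negligibleP.
  by apply: measurableI => //; exact: (bF n).1.
exact: (bF n).2.
Qed.

Lemma maximal_singular_family : exists F : set cell,
  [/\ forall be, F be -> measurable be.2,
      forall be ga, F be -> F ga -> be <> ga -> cells_singular be ga &
      forall m E, measurable E -> (forall be, F be -> cells_singular (m, E) be) ->
        nu m E = 0%E].
Proof.
pose P (F : set cell) :=
  (forall be, F be -> measurable be.2 /\ nu be.1 be.2 <> 0%E) /\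
  forall be ga, F be -> F ga -> be <> ga -> cells_singular be ga.
have [G GP Gtot|F [[F1 F2] Fmax]] := @Zorn_bigcup cell P.
  split=> [be [F GF Fbe]|be ga [F GF Fbe] [F' GF' Fga] ne]; first exact: (GP F GF).1.
  have [FF'|F'F] := Gtot _ _ GF GF'.
  - by apply: (GP F' GF').2 => //; exact: FF'.
  - by apply: (GP F GF).2 => //; exact: F'F.
exists F; split => //; first by move=> be /F1[].
move=> m E mE Esing; apply/eqP/negPn/negP => /eqP nuE.
(* A cell singular to itself is null, so [(m, E)] would be a new member and contradict
   maximality. *)
have FE : ~ F (m, E).
  move=> /Esing[W [[mW]]]/= h1 [_ /= h2]; apply: nuE.
  have -> : E = (E `&` W) `|` (E `&` ~` W) by rewrite -setIUr setUCr setIT.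
  by rewrite measureU0//; apply: measurableI => //; exact: measurableC.
apply: (Fmax (F `|` [set (m, E)])).
  split=> [|sub]; first exact: subsetUl.
  by apply: FE; apply: sub; right.
split=> [be [/F1//|-> //]|be ga].
move=> [Fbe|->] [Fga|->] // ne; [exact: F2|exact/cells_singularC/Esing|exact: Esing].
Qed.

Section Carriers.
Variable F : set cell.
Hypothesis F_meas : forall be, F be -> measurable be.2.
Hypothesis F_sing : forall be ga, F be -> F ga -> be <> ga -> cells_singular be ga.
Hypothesis F_max : forall m E, measurable E ->
  (forall be, F be -> cells_singular (m, E) be) -> nu m E = 0%E.

(** A Lebesgue decomposition: [Z m be] is the [nu m]-largest set that is null for the cell [be], so
    [nu m] is absolutely continuous with respect to [be] on its complement, here called the
    carrier. *)
Lemma maximal_null_sets : exists Z : M -> cell -> set T, forall m be, F be ->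
  cell_null be (Z m be) /\ forall Z', cell_null be Z' -> nu m (Z' `\` Z m be) = 0%E.
Proof.
suff /choice[Z ZP] : forall x : M * cell, exists Z, F x.2 ->
    cell_null x.2 Z /\ forall Z', cell_null x.2 Z' -> nu x.1 (Z' `\` Z) = 0%E.
  by exists (fun m be => Z (m, be)) => m be /(ZP (m, be)).
move=> [m be]/=; have [Fbe|] := pselect (F be); last by exists set0.
have [| | |Y Y1 Y2] := @sigma_ideal_maximal _ _ _ (nu m) (cell_null be) (nu_fin m).
- by move=> A [].
- by exists set0; split => //; rewrite setI0 measure0.
- by move=> G GP; apply: cell_null_bigcup => //; exact: F_meas.
- by exists Y.
Qed.

Variable Z : M -> cell -> set T.
Hypothesis Z_null : forall m be, F be -> cell_null be (Z m be).
Hypothesis Z_max : forall m be Z', F be -> cell_null be Z' ->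
  nu m (Z' `\` Z m be) = 0%E.

(** A set separating the two cells is almost contained in [Z m be], and its complement in [Z m ga];
    together these cover almost everything. *)
Lemma carriers_disjoint m be ga : F be -> F ga -> be <> ga ->
  nu m (~` Z m be `&` ~` Z m ga) = 0%E.
Proof.
move=> Fbe Fga ne; have [W [beW gaW]] := F_sing Fbe Fga ne.
have mZbe := (Z_null m Fbe).1; have mZga := (Z_null m Fga).1.
apply/eqP; rewrite eq_le measure_ge0 andbT.
apply: (@le_trans _ _ (nu m ((W `\` Z m be) `|` (~` W `\` Z m ga)))).
  apply: le_measure.
  - by apply: mem_set; apply: measurableI; exact: measurableC.
  - apply: mem_set; apply: measurableU; apply: measurableD => //.
    + exact: beW.1.
    + exact: gaW.1.
  - move=> x [xbe xga]; have [xW|xW] := pselect (W x); first by left.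
    by right.
rewrite measureU0 ?(Z_max m Fbe beW) ?(Z_max m Fga gaW)//.
- by apply: measurableD => //; exact: beW.1.
- by apply: measurableD => //; exact: gaW.1.
Qed.

(** A [nu m]-maximal countable union of carriers almost contains each carrier, so [nu m] outside it
    is singular to the whole family and vanishes by [F_max]. Continuity from above then leaves
    finitely many carriers. *)
Lemma finitely_many_carriers m (e : R) : 0 < e ->
  exists s : seq cell, [/\ uniq s, forall be, be \in s -> F be &
    (nu m (\bigcap_(be in [set` s]) Z m be) <= e%:E)%E].
Proof.
move=> e0.
(* [None] contributes the empty set, so sequences exist even when [F] is empty. *)
pose car (o : option cell) := if o is Some be then ~` Z m be else set0.
pose ok (o : option cell) := if o is Some be then F be else True.
have mcar o : ok o -> measurable (car o).
  by case: o => [be /= Fbe|_]//=; apply: measurableC; exact: (Z_null m Fbe).1.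
pose P U := exists2 o : nat -> option cell, (forall n, ok (o n)) &
  U = \bigcup_n car (o n).
have [| | |U [w wP UE] Umax] := @sigma_ideal_maximal _ _ _ (nu m) P (nu_fin m).
- by move=> A [w wP ->]; apply: bigcupT_measurable => n; exact: mcar.
- by exists (\bigcup_(n : nat) car None); exists (fun=> None).
- move=> G GP; have /choice[w wP] n : exists w : nat -> option cell,
      (forall k, ok (w k)) /\ G n = \bigcup_k car (w k).
    by have [w ? ?] := GP n; exists w.
  exists (fun i => if (choice.unpickle i : option (nat * nat)) is Some (n, k) then w n k else None).
    by move=> i; case: choice.unpickle => [[n k]|//]; exact: (wP n).1.
  apply/seteqP; split=> [x [n _]|x [i _]].
    rewrite (wP n).2 => -[k _ xk]; exists (choice.pickle (n, k)) => //.
    by rewrite choice.pickleK.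
  case: choice.unpickle => [[n k]|//] xk; exists n => //.
  by rewrite (wP n).2; exists k.
have mU : measurable U by rewrite UE; apply: bigcupT_measurable => n; exact: mcar.
have nuU : nu m (~` U) = 0%E.
  apply: F_max => [|be Fbe]; first exact: measurableC.
  exists (~` Z m be); split; last by rewrite setCK; exact: Z_null.
  split=> /=; first by apply: measurableC; exact: (Z_null m Fbe).1.
  rewrite setIC -setDE; apply: Umax; exists (fun=> Some be) => //.
  by rewrite bigcup_const//; exists 0%N.
pose C n := ~` \bigcup_(k < n) car (w k).
have mC n : measurable (C n).
  by apply: measurableC; apply: bigcup_measurable => k _; exact: mcar.
have capC : \bigcap_n C n = ~` U.
  rewrite UE -setC_bigcup; congr (~` _).
  apply/seteqP; split=> [x [n _ [k _ xk]]|x [k _ xk]]; first by exists k.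
  by exists k.+1 => //; exists k => /=.
have : nu m (C n) @[n --> \oo] --> (0 : \bar R)%E.
  rewrite -nuU -capC; apply: nonincreasing_cvg_mu => //.
  - apply: le_lt_trans (nu_fin m); apply: le_measure => //; exact: mem_set.
  - by rewrite capC; exact: measurableC.
  - move=> n n' nn'; apply/subsetPset; apply: subsetC.
    by move=> x [k /= kn xk]; exists k => //=; exact: leq_trans nn'.
move=> /fine_cvgP[_ /cvgrPdist_le/(_ e e0)[n _ /(_ n (leqnn n))/=]].
have fin : nu m (C n) \is a fin_num.
  rewrite ge0_fin_numE//; apply: le_lt_trans (nu_fin m).
  by apply: le_measure => //; exact: mem_set.
rewrite sub0r normrN ger0_norm ?fine_ge0// -lee_fin fineK// => Cn.
have sP be : be \in undup (pmap w (iota 0 n)) ->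
    exists2 k, (k < n)%N & w k = Some be.
  rewrite mem_undup mem_pmap => /mapP[k]; rewrite mem_iota add0n => /andP[_ kn] wk.
  by exists k.
exists (undup (pmap w (iota 0 n))); split; first exact: undup_uniq.
  by move=> be /sP[k _ ok_be]; have := wP k; rewrite ok_be.
apply: le_trans Cn; apply: le_measure.
- apply: mem_set; apply: fin_bigcap_measurable => [|be].
    exact: finite_seq.
  by move=> /sP[k _ ok_be]; have := wP k; rewrite ok_be => /(Z_null m)[].
- exact: mem_set.
- move=> x xs [k /= kn]; case ok_be : (w k) => [be|//] /=; apply; apply: xs => /=.
  rewrite mem_undup mem_pmap; apply/mapP; exists k => //.
  by rewrite mem_iota.
Qed.

End Carriers.
End Atomization.

(** * Gentle weights on a factor *)

Section MeanFunctional.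
Context {R : realType}.
Variables (a : R) (J : (R -> R) -> R).

Definition radially_bounded (f : R -> R) :=
  exists k : R, forall r, a <= r <= 2 * a -> `|f r| <= k.

Hypothesis JD : forall f g, radially_bounded f -> radially_bounded g ->
  J (fun r => f r + g r) = J f + J g.
Hypothesis JZ : forall c f, radially_bounded f -> J (fun r => c * f r) = c * J f.
Hypothesis Jle : forall f g, radially_bounded f -> radially_bounded g ->
  (forall r, a <= r <= 2 * a -> f r <= g r) -> J f <= J g.
Hypothesis Jc : forall c, J (fun=> c) = c.

Lemma radially_bounded_cst c : radially_bounded (fun=> c).
Proof. by exists `|c|. Qed.

Lemma radially_boundedD f g : radially_bounded f -> radially_bounded g ->
  radially_bounded (fun r => f r + g r).
Proof.
move=> [k fk] [l gl]; exists (k + l) => r ar.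
by rewrite (le_trans (ler_normD _ _))// lerD ?fk ?gl.
Qed.

Lemma radially_boundedZ c f : radially_bounded f -> radially_bounded (fun r => c * f r).
Proof.
by move=> [k fk]; exists (`|c| * k) => r ar; rewrite normrM ler_wpM2l ?fk.
Qed.

Lemma radially_bounded_norm f : radially_bounded f -> radially_bounded (fun r => `|f r|).
Proof. by move=> [k fk]; exists k => r ar; rewrite normr_id fk. Qed.

Lemma radially_bounded_sum n (f : 'I_n -> R -> R) : (forall i, radially_bounded (f i)) ->
  radially_bounded (fun r => \sum_(i < n) f i r).
Proof.
move=> /choice[k fk]; exists (\sum_(i < n) k i) => r ar.
by rewrite (le_trans (ler_norm_sum _ _ _))// ler_sum// => i _; exact: fk.
Qed.

Lemma mean_eq f g : radially_bounded f -> radially_bounded g ->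
  (forall r, a <= r <= 2 * a -> f r = g r) -> J f = J g.
Proof.
move=> fb gb fg; apply/eqP; rewrite eq_le.
by apply/andP; split; apply: Jle => // r /fg ->.
Qed.

Lemma mean_sum n (f : 'I_n -> R -> R) : (forall i, radially_bounded (f i)) ->
  J (fun r => \sum_(i < n) f i r) = \sum_(i < n) J (f i).
Proof.
elim: n f => [|n IH] f fb.
  by rewrite big_ord0 -[RHS](Jc 0); congr J; apply/funext => r; rewrite big_ord0.
rewrite big_ord_recl -IH// -JD//; last exact: radially_bounded_sum.
by congr J; apply/funext => r; rewrite big_ord_recl.
Qed.

Lemma mean_dist f g : radially_bounded f -> radially_bounded g ->
  `|J f - J g| <= J (fun r => `|f r - g r|).
Proof.
move=> fb gb.
have fgb : radially_bounded (fun r => f r + -1 * g r).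
  by apply: radially_boundedD => //; exact: radially_boundedZ.
have -> : (fun r => `|f r - g r|) = (fun r => `|f r + -1 * g r|).
  by apply/funext => r; rewrite mulN1r.
have -> : J f - J g = J (fun r => f r + -1 * g r).
  by rewrite JD//; [rewrite JZ// mulN1r|exact: radially_boundedZ].
have nb := radially_bounded_norm fgb.
rewrite ler_norml; apply/andP; split; last by apply: Jle => // r _; exact: ler_norm.
rewrite lerNl -[leLHS]mulN1r -JZ//; apply: Jle => //; first exact: radially_boundedZ.
by move=> r _; rewrite [leLHS]mulN1r -[leRHS]normrN ler_norm.
Qed.

Lemma mean_sum_dist n (f g : 'I_n -> R -> R) h :
  (forall i, radially_bounded (f i)) -> (forall i, radially_bounded (g i)) ->
  radially_bounded h ->
  (forall r, a <= r <= 2 * a -> \sum_(i < n) `|f i r - g i r| <= h r) ->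
  \sum_(i < n) `|J (f i) - J (g i)| <= J h.
Proof.
move=> fb gb hb fgh.
have fgb i : radially_bounded (fun r => `|f i r - g i r|).
  apply: radially_bounded_norm; have [[k fk] [l gl]] := (fb i, gb i).
  exists (k + l) => r ar; rewrite (le_trans (ler_normB _ _))//.
  by rewrite lerD ?fk ?gl.
apply: (@le_trans _ _ (\sum_(i < n) J (fun r => `|f i r - g i r|))).
  by apply: ler_sum => i _; exact: mean_dist.
by rewrite -mean_sum//; apply: Jle => //; exact: radially_bounded_sum.
Qed.

End MeanFunctional.

Lemma measurable_partition d (T : measurableType d) (n : nat) (E : nat -> set T) :
  (forall i, measurable (E i)) -> exists F : 'I_n.+1 -> set T,
  [/\ forall i, measurable (F i), trivIset setT F, \bigcup_i F i = setT,
      forall i : 'I_n.+1, (i < n)%N -> F i = seqDU E i &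
      F ord_max = ~` \bigcup_(j < n) E j].
Proof.
move=> mE; pose F (i : 'I_n.+1) := if (i < n)%N then seqDU E i else ~` \bigcup_(j < n) E j.
have mU : measurable (\bigcup_(j < n) E j) by apply: bigcup_measurable.
exists F; split.
- move=> i; rewrite /F; case: ifP => _; last exact: measurableC.
  exact: seqDU_measurable.
- have H (i j : 'I_n.+1) x : F i x -> F j x -> (i < n)%N -> i = j :> nat.
    rewrite /F => + + ilt; rewrite ilt; case: ifP => jlt ix jx.
      by apply: (@trivIset_seqDU _ E) => //; exists x.
    by exfalso; apply: jx; exists i => //; exact: subset_seqDU ix.
  move=> i j _ _ [x [ix jx]]; apply/val_inj => /=.
  have [ilt|ige] := ltnP i n; first exact: (H i j x).
  have [jlt|jge] := ltnP j n; first by apply/esym; exact: (H j i x).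
  by apply/eqP; rewrite eqn_leq (leq_trans _ jge) ?(leq_trans _ ige)//;
    rewrite -ltnS ltn_ord.
- apply/seteqP; split => // x _.
  have [[j /= jn jx]|nx] := pselect ((\bigcup_(j < n) E j) x); last first.
    by exists ord_max => //; rewrite /F /= ltnn.
  have : (\bigcup_(j in `I_n) E j) x by exists j.
  rewrite bigcup_mkord bigsetU_seqDU -bigcup_mkord => -[k /= kn kx].
  by exists (Ordinal (ltnW kn : (k < n.+1)%N)) => //; rewrite /F /= kn.
- by move=> i ilt; rewrite /F ilt.
- by rewrite /F /= ltnn.
Qed.

(** * Weights by radial averaging of carried masses *)

Section RadialWeights.
Context {R : realType} {M : pmetricType R}.
Variable mu : M -> {measure set (borel M) -> \bar R}.
Hypothesis mu_ph : pointwise_homogeneous mu.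
Variable a : R.
Hypothesis a0 : 0 < a.

Local Notation cell := (M * set (borel M))%type.
Local Notation C := (consistency_constant mu).
Local Notation D := (doubling_constant mu).
Implicit Types (m : M) (be ga : cell).

(** A finite measure whose ball contains every ball about [m] of radius between [a] and [2 * a]; its
    null sets therefore affect none of the densities. *)
Let nu m : {measure set (borel M) -> \bar R} :=
  mrestr (mu m) (measurable_ball m (2 * a)).

Let nuE m A : nu m A = mu m (A `&` ball m (2 * a)).
Proof. by []. Qed.

Let nu_fin m : (nu m setT < +oo)%E.
Proof.
rewrite nuE setTI -ge0_fin_numE//; apply: (mass_fin mu_ph); exact: bounded_ball.
Qed.

Let density m (A : set (borel M)) r :=
  mass mu m (A `&` ball m r) / ball_mass mu m r.

Let density_itv m A r : measurable A -> a <= r <= 2 * a -> 0 <= density m A r <= 1.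
Proof.
move=> mA /andP[ar _]; have r0 : 0 < r by exact: lt_le_trans ar.
have v0 := ball_mass_gt0 mu_ph m r0.
rewrite divr_ge0 ?mass_ge0 ?(ltW v0)//= ler_pdivrMr// mul1r.
apply: (le_mass mu_ph); last exact: subIsetr.
  by apply: measurableI => //; exact: measurable_ball.
exact: bounded_ball.
Qed.

Let density_bounded m A : measurable A -> radially_bounded a (density m A).
Proof.
move=> mA; exists 1 => r ar; have /andP[h1 h2] := density_itv m mA ar.
by rewrite ger0_norm.
Qed.

Let density_null m A B r : measurable A -> measurable B -> A `<=` B ->
  nu m (B `\` A) = 0%E -> a <= r <= 2 * a -> density m A r = density m B r.
Proof.
move=> mA mB AB BA0 /andP[_ r2]; rewrite /density; congr (_ / _).
rewrite /mass; congr fine.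
have -> : B `&` ball m r = (A `&` ball m r) `|` ((B `\` A) `&` ball m r).
  by rewrite -setIUl setDUK.
have mb := measurable_ball m r.
rewrite measureU0//; [exact: measurableI|by apply: measurableI => //; exact: measurableD|].
apply/eqP; rewrite eq_le measure_ge0 andbT -BA0 nuE; apply: le_measure.
- by apply: mem_set; apply: measurableI => //; exact: measurableD.
- apply: mem_set; apply: measurableI; [exact: measurableD|exact: measurable_ball].
- by apply: setIS; exact: subset_ball_le.
Qed.

Let density_sum m n (F : 'I_n -> set (borel M)) r : a <= r <= 2 * a ->
  (forall i, measurable (F i)) -> trivIset setT F -> \bigcup_i F i = setT ->
  \sum_(i < n) density m (F i) r = 1.
Proof.
move=> /andP[ar _] mF tF FT; have r0 : 0 < r by exact: lt_le_trans ar.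
rewrite -mulr_suml (mass_sum mu_ph m (A := ball m r)) ?divff//.
- by rewrite gt_eqF// (ball_mass_gt0 mu_ph).
- by move=> i; apply: measurableI => //; exact: measurable_ball.
- exact: trivIset_setIr.
- by rewrite -setI_bigcupl FT setTI.
- exact: bounded_ball.
Qed.

Let shell_itv t r : 0 < t -> t <= a / 4 -> a <= r -> r <= 2 * a ->
  [/\ a / 2 <= r - t, r - t <= r + t, r + t <= 4 * a & t < r].
Proof. by have := a0 => *; split; lra. Qed.

(** The weight of a cell is the radial mean of the normalized mass on its carrier. In the last bound
    [2 * C] comes from the change of measure, [24 = 2 * 4 * 3] from the shift of a logarithm over
    three doublings, and 8 covers centres farther apart than [a / 4]. *)
Lemma radial_weights : exists w : M -> cell -> R,
  [/\ forall m be, 0 <= w m be,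
      forall m (s : seq cell), uniq s -> \sum_(be <- s) w m be <= 1,
      forall m, exists2 s : seq cell, uniq s & 3 / 4 <= \sum_(be <- s) w m be,
      forall m be, w m be != 0 -> mdist m be.1 <= 4 * a &
      forall m m' (s : seq cell), uniq s ->
        \sum_(be <- s) `|w m be - w m' be| <=
        (2 * C + 24 * ln D + 8) * (mdist m m' / a)].
Proof.
have [J [JD JZ Jle Jc Jshift]] := radial_mean a0.
have [F [F_meas F_sing F_max]] := maximal_singular_family nu.
have [Z ZP] := maximal_null_sets nu_fin F_meas.
have Z_null m be : F be -> cell_null nu be (Z m be) by move=> /(ZP m)[].
have Z_max m be Z' : F be -> cell_null nu be Z' -> nu m (Z' `\` Z m be) = 0%E.
  by move=> /(ZP m)[_]; apply.
have mZ m be : F be -> measurable (Z m be) by move=> /(Z_null m)[].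
pose w m be := if pselect (F be) then J (density m (~` Z m be)) else 0.
have wF m be : F be -> w m be = J (density m (~` Z m be)).
  by rewrite /w; case: pselect.
have wnF m be : ~ F be -> w m be = 0 by rewrite /w; case: pselect.
have db m be : F be -> radially_bounded a (density m (~` Z m be)).
  by move=> Fbe; apply: density_bounded; apply: measurableC; exact: mZ.
(* Only finitely many cells are compared at a time, so their carriers can be
   made disjoint, up to null sets, for two centers at once. *)
have partition m m' (s : seq cell) : uniq s -> (forall be, be \in s -> F be) ->
    exists P : 'I_(size s).+1 -> set (borel M),
    [/\ forall i, measurable (P i), trivIset setT P, \bigcup_i P i = setT,
        forall (i : 'I_(size s)) r be0, a <= r <= 2 * a ->
          density m (P (widen_ord (leqnSn _) i)) r =
            density m (~` Z m (nth be0 s i)) r /\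
          density m' (P (widen_ord (leqnSn _) i)) r =
            density m' (~` Z m' (nth be0 s i)) r &
        P ord_max = \bigcap_(be in [set` s]) (Z m be `|` Z m' be)].
  move=> us sF; set n := size s; pose be0 : cell := (point, setT).
  pose E i := if (i < n)%N then ~` (Z m (nth be0 s i) `|` Z m' (nth be0 s i)) else set0.
  have Fnth i : (i < n)%N -> F (nth be0 s i) by move=> ilt; apply: sF; exact: mem_nth.
  have mE i : measurable (E i).
    by rewrite /E; case: ifP => // ilt; apply/measurableC/measurableU; apply: mZ; exact: Fnth.
  have [P [mP tP PT PE Pmax]] := measurable_partition n mE.
  have core m1 i r : m1 = m \/ m1 = m' -> (i < n)%N -> a <= r <= 2 * a ->
      density m1 (seqDU E i) r = density m1 (~` Z m1 (nth be0 s i)) r.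
    move=> mm ilt ar; have Fbe := Fnth i ilt; set be := nth be0 s i in Fbe *.
    apply: density_null => //; first exact: seqDU_measurable.
    - by apply: measurableC; exact: mZ.
    - apply: subset_trans (@subset_seqDU _ E i) _; rewrite /E ilt; apply: subsetC.
      by case: mm => ->; [exact: subsetUl|exact: subsetUr].
    (* What a disjoint piece misses of the carrier: points of the null sets of either centre, and
       overlaps with earlier carriers. *)
    have neg : (nu m1).-negligible ((Z m be `\` Z m1 be) `|` (Z m' be `\` Z m1 be) `|`
        \bigcup_(j < i) (~` Z m1 be `&` ~` Z m1 (nth be0 s j))).
      apply: negligibleU; first apply: negligibleU.
      - apply/negligibleP; first by apply: measurableD; exact: mZ.
        by apply: Z_max => //; exact: Z_null.
      - apply/negligibleP; first by apply: measurableD; exact: mZ.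
        by apply: Z_max => //; exact: Z_null.
      - rewrite bigcup_mkcond; apply: negligible_bigcup => j.
        case: ifPn => [/set_mem/= ji|_]; last exact: negligible_set0.
        have jlt := ltn_trans ji ilt; have Fj := Fnth j jlt.
        apply/negligibleP.
          by apply: measurableI; apply: measurableC; exact: mZ.
        apply: (carriers_disjoint F_sing Z_null Z_max) => // /eqP.
        by rewrite nth_uniq// => /eqP ij; rewrite ij ltnn in ji.
    have mX : measurable (~` Z m1 be `\` seqDU E i).
      apply: measurableD; [by apply: measurableC; exact: mZ|exact: seqDU_measurable].
    apply/negligibleP => //; apply: negligibleS neg => x [xZ1 xE].
    have [xU|xU] := pselect ((Z m be `|` Z m' be) x).
      by left; case: xU => xZ; [left|right].
    right; apply: contrapT => nx; apply: xE; split.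
      by rewrite /E ilt.
    rewrite -bigcup_mkord => -[j /= ji]; rewrite /E (ltn_trans ji ilt) => xj.
    apply: nx; exists j => //; split => // xZj; apply: xj.
    by case: mm => mm; rewrite mm in xZj; [left|right].
  exists P; split => //.
  - move=> i r be1 ar; rewrite (PE (widen_ord _ i)) ?ltn_ord//=.
    rewrite (set_nth_default be0)//.
    by split; apply: core => //; [left|right].
  - rewrite Pmax setC_bigcup; apply/seteqP; split => [x xE be /= /(nthP be0)[i ilt <-]|x xZ i /= ilt].
      by have := xE i ilt; rewrite /E ilt setCK.
    by rewrite /E ilt => xE; apply: xE; apply: xZ => /=; exact: mem_nth.
have sumF (s : seq cell) (G : cell -> R) : (forall be, ~ F be -> G be = 0) ->
    \sum_(be <- s) G be = \sum_(be <- [seq be <- s | `[< F be >]]) G be.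
  move=> G0; rewrite big_filter [RHS]big_mkcond/=; apply: eq_bigr => be _.
  by case: asboolP => // /G0.
have filterF (s : seq cell) be : be \in [seq be <- s | `[< F be >]] -> F be.
  by rewrite mem_filter => /andP[/asboolP].
have w_ge0 m be : 0 <= w m be.
  have [Fbe|nFbe] := pselect (F be); last by rewrite wnF.
  rewrite wF// -[leLHS](Jc 0); apply: Jle.
  - exact: radially_bounded_cst.
  - exact: db.
  - move=> r ar; have mC : measurable (~` Z m be) by apply: measurableC; exact: mZ.
    by have /andP[] := density_itv m mC ar.
have w_sumE m (s : seq cell) be0 : (forall be, be \in s -> F be) ->
    \sum_(be <- s) w m be = J (fun r => \sum_(i < size s) density m (~` Z m (nth be0 s i)) r).
  move=> sF; rewrite (mean_sum JD Jc); last first.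
    by move=> i; apply: db; apply: sF; exact: mem_nth.
  rewrite (big_nth be0) big_mkord; apply: eq_bigr => i _.
  by rewrite wF//; apply: sF; exact: mem_nth.
(* The carriers tile the complement of the common null set up to negligible overlaps. *)
have density_cells m (s : seq cell) be0 r : uniq s -> (forall be, be \in s -> F be) ->
    a <= r <= 2 * a ->
    \sum_(i < size s) density m (~` Z m (nth be0 s i)) r =
    1 - density m (\bigcap_(be in [set` s]) Z m be) r.
  move=> us sF ar; have [P [mP tP PT PE Pmax]] := partition m m s us sF.
  rewrite -(density_sum m ar mP tP PT) big_ord_recr/= Pmax.
  have -> : \bigcap_(be in [set` s]) (Z m be `|` Z m be) = \bigcap_(be in [set` s]) Z m be.
    by apply: eq_bigcapr => be _; rewrite setUid.
  by rewrite addrK; apply: eq_bigr => i _; rewrite (PE i r be0 ar).1.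
have mcap m (s : seq cell) : (forall be, be \in s -> F be) ->
    measurable (\bigcap_(be in [set` s]) Z m be).
  move=> sF; apply: fin_bigcap_measurable => [|be /= /sF]; first exact: finite_seq.
  exact: mZ.
have sum_bounded m (s : seq cell) be0 : (forall be, be \in s -> F be) ->
    radially_bounded a (fun r => \sum_(i < size s) density m (~` Z m (nth be0 s i)) r).
  move=> sF; apply: radially_bounded_sum => i; apply: db; apply: sF; exact: mem_nth.
pose be0 : cell := (point, setT).
have w_sum m (s : seq cell) : uniq s -> \sum_(be <- s) w m be <= 1.
  move=> us; rewrite sumF//; last exact: wnF.
  rewrite (w_sumE m _ be0)//; last exact: filterF.
  rewrite -[leRHS](Jc 1); apply: Jle.
  - by apply: sum_bounded; exact: filterF.
  - exact: radially_bounded_cst.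
  - move=> r ar; rewrite density_cells ?filter_uniq//; last exact: filterF.
    have /andP[] := density_itv m (mcap m _ (filterF s)) ar.
    by rewrite gerBl.
exists w; split => //.
- move=> m; have v0 := ball_mass_gt0 mu_ph m a0.
  (* The part missed inside [ball m (2 * a)] is at most a quarter of the smallest ball used, hence a
     quarter of the mass at every radius. *)
  have e0 : 0 < ball_mass mu m a / 4 by rewrite divr_gt0.
  have [s [us sF nus]] := finitely_many_carriers nu_fin F_max Z_null m e0.
  exists s => //; rewrite (w_sumE m _ be0)// -[leLHS](Jc (3 / 4)); apply: Jle.
  + exact: radially_bounded_cst.
  + exact: sum_bounded.
  move=> r ar; rewrite density_cells//.
  suff : density m (\bigcap_(be in [set` s]) Z m be) r <= 1 / 4 by lra.
  have ar' := ar; move/andP : ar' => [ar1 ar2].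
  have r0 : 0 < r by exact: lt_le_trans ar1.
  rewrite ler_pdivrMr ?(ball_mass_gt0 mu_ph)//.
  have := le_ball_mass mu_ph m ar1.
  suff : mass mu m (\bigcap_(be in [set` s]) Z m be `&` ball m r) <= ball_mass mu m a / 4.
    by lra.
  rewrite -lee_fin (massE mu_ph); last by apply: bounded_measI; exact: mcap.
  apply: le_trans nus; rewrite nuE; apply: le_measure.
  + by apply: mem_set; apply: measurableI; [exact: mcap|exact: measurable_ball].
  + by apply: mem_set; apply: measurableI; [exact: mcap|exact: measurable_ball].
  + by apply: setIS; exact: subset_ball_le.
- move=> m be wn0; rewrite leNgt; apply: contra_neqN wn0 => far.
  have [Fbe|nFbe] := pselect (F be); last by rewrite wnF.
  rewrite wF// -[RHS](Jc 0); apply: (mean_eq Jle).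
  + exact: db.
  + exact: radially_bounded_cst.
  move=> r ar; rewrite -(@density_null m set0 _ r)//.
  + by rewrite /density set0I /mass measure0 mul0r.
  + by apply: measurableC; exact: mZ.
  (* A cell based farther than [4 * a] away gives no mass to [ball m (2 * a)], so by maximality that
     ball lies almost entirely in [Z m be]. *)
  rewrite setD0; have ballZ : cell_null nu be (ball m (2 * a)).
    split; first exact: measurable_ball.
    rewrite nuE (_ : _ `&` _ = set0) ?measure0//.
    rewrite -subset0 => x [[_]]; rewrite !ballEmdist/= => mx bex.
    have := metric_triangle m x be.1; rewrite (metric_sym x) leNgt => /negP; apply.
    by rewrite (le_lt_trans _ far)//; lra.
  have := Z_max m be _ Fbe ballZ; rewrite !nuE => <-; congr (mu m _).
  by rewrite setDE setIAC setIid setIC.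
move=> m m' s us; set d := mdist m m'.
have d0 : 0 <= d := mdist_ge0 m m'.
have D1 := doubling_constant_ge1 mu_ph.
have D0 : 0 < doubling_constant mu by exact: lt_le_trans D1.
have lnD0 : 0 <= ln D by exact: ln_ge0.
have C0 := consistency_constant_ge0 mu.
have da0 : 0 <= d / a by rewrite divr_ge0// ltW.
(* For distant centres the trivial bound 2 on the difference suffices. *)
have [far|near] := ltP (a / 4) d.
  apply: (@le_trans _ _ (\sum_(be <- s) (w m be + w m' be))).
    apply: ler_sum => be _; rewrite (le_trans (ler_normB _ _))//.
    by rewrite !ger0_norm.
  have : 1 <= 4 * (d / a) by rewrite mulrA ler_pdivlMr//; lra.
  rewrite big_split/=; have := w_sum m s us; have := w_sum m' s us.
  set x := \sum_(_ <- _) _; set y := \sum_(_ <- _) _.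
  have := mulr_ge0 C0 da0; have := mulr_ge0 lnD0 da0.
  lra.
have [dE|dn0] := eqVneq d 0.
  rewrite dE mul0r mulr0 (mdist_positivity m m' dE) big1// => be _.
  by rewrite subrr normr0.
have dp : 0 < d by rewrite lt_neqAle eq_sym dn0.
rewrite sumF; last by move=> be nF; rewrite !wnF// subrr normr0.
set s' := [seq be <- s | `[< F be >]]; have s'F : forall be, be \in s' -> F be by exact: filterF.
have us' : uniq s' by exact: filter_uniq.
rewrite (big_nth be0) big_mkord.
have Fnth (i : 'I_(size s')) : F (nth be0 s' i) by apply: s'F; exact: mem_nth.
under eq_bigr => i _ do rewrite !wF//.
pose G r := ln (ball_mass mu m' r).
pose h r := 2 * (C * (d / a)) + 2 * (G (r + d) - G (r - d)).
have Gm r t : a / 2 <= r -> r <= t -> t <= 4 * a -> G r <= G t.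
  move=> ar rt _; have r0 : 0 < r by rewrite (lt_le_trans _ ar)// divr_gt0.
  have t0 : 0 < t by exact: lt_le_trans rt.
  by rewrite /G ler_ln ?posrE ?(ball_mass_gt0 mu_ph)//; exact: (le_ball_mass mu_ph).
have Gb : radially_bounded a (fun r => G (r + d) - G (r - d)).
  exists (G (4 * a) - G (a / 2)) => r /andP[r1 r2].
  have [b1 b2 b3] : [/\ a / 2 <= r - d, r - d <= r + d & r + d <= 4 * a].
    by have [] := shell_itv dp near r1 r2.
  have h1 : G (r - d) <= G (r + d) by exact: Gm.
  rewrite ger0_norm ?subr_ge0// lerB//; apply: Gm => //.
    exact: le_trans b1 b2.
  exact: le_trans b2 b3.
have Gb2 := radially_boundedZ 2 Gb.
have hb : radially_bounded a h.
  by apply: radially_boundedD => //; exact: radially_bounded_cst.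
apply: (@le_trans _ _ (J h)).
  apply: (mean_sum_dist JD JZ Jle Jc) => // [i|i|r ar]; try exact: db.
  have [P [mP tP PT PE _]] := partition m m' s' us' s'F.
  have ar' := ar; move/andP : ar' => [ar1 ar2].
  have dr : mdist m m' < r.
    by rewrite -/d; have [] := shell_itv dp near ar1 ar2.
  have := ball_ratio_dist mu_ph dr mP tP PT; rewrite big_ord_recr/=.
  under eq_bigr => i _ do
    rewrite -[_ / _]/(density m _ r) -[_ / ball_mass _ m' _]/(density m' _ r)
      (PE i r be0 ar).1 (PE i r be0 ar).2.
  set x := \sum_(_ < _) _; set y := `|_| => xy.
  have : C * (d / r) <= C * (d / a).
    by rewrite ler_wpM2l// ler_wpM2l// lef_pV2 ?posrE// (lt_le_trans a0).
  rewrite /h /G; have : 0 <= y by exact: normr_ge0.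
  by move: xy; rewrite -/d; lra.
have -> : J h = 2 * (C * (d / a)) + 2 * J (fun r => G (r + d) - G (r - d)).
  have := JD _ _ (radially_bounded_cst a (2 * (C * (d / a)))) Gb2.
  by rewrite (JZ _ _ Gb) Jc.
have := Jshift G d dp near Gm.
(* Three doublings lead from [a / 2] to [4 * a]. *)
have G3 : G (4 * a) - G (a / 2) <= 3 * ln D.
  have dbl t : 0 < t -> G (2 * t) <= ln D + G t.
    move=> t0; have v0 := ball_mass_gt0 mu_ph m' t0.
    rewrite /G -lnM ?posrE// ler_ln ?posrE ?mulr_gt0//.
      exact: ball_mass_double.
    by apply: ball_mass_gt0 => //; rewrite mulr_gt0.
  have a2 : 0 < a / 2 by rewrite divr_gt0.
  have aa : 2 * (a / 2) = a by field.
  have a4 : 2 * (2 * a) = 4 * a by ring.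
  have a20 : 0 < 2 * a by rewrite mulr_gt0.
  have := dbl _ a2; have := dbl _ a0; have := dbl _ a20; rewrite aa a4; lra.
have : 4 * d / a * (G (4 * a) - G (a / 2)) <= 4 * d / a * (3 * ln D).
  by rewrite ler_wpM2l// -mulrA mulr_ge0.
move=> h1 h2; have h3 := le_trans h2 h1.
have -> : (2 * C + 24 * ln D + 8) * (d / a) =
  2 * (C * (d / a)) + 2 * (4 * d / a * (3 * ln D)) + 8 * (d / a) by ring.
by move: h3; set X := J _; set Y := 4 * d / a * _; lra.
Qed.

End RadialWeights.

(** * Passing to finitely supported weights *)

Section SoftThreshold.
Context {R : realType} {B : choiceType}.
Implicit Types (v : B -> R) (s : seq B) (t : R).

Let excess v t be : R := Num.max (v be - t) 0.

Let excess_ge0 v t be : 0 <= excess v t be.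
Proof. by rewrite /excess le_max lexx orbT. Qed.

Let excess_le v t t' be : t <= t' -> excess v t' be <= excess v t be.
Proof.
by move=> tt'; rewrite /excess ge_max !le_max lexx orbT andbT lerB.
Qed.

Let excess_dist v v' t be : `|excess v t be - excess v' t be| <= `|v be - v' be|.
Proof.
rewrite /excess; set x := v be; set y := v' be.
have -> : `|x - y| = `|(x - t) - (y - t)| by congr `|_|; ring.
rewrite ler_norml; have := ler_norm (x - t - (y - t)); have := ler_norm (- (x - t - (y - t))).
rewrite normrN; set z := `|_|.
by case: (lerP (x - t) 0); case: (lerP (y - t) 0) => *; apply/andP; split; lra.
Qed.

Let sum_excess_continuous v s : continuous (fun t => \sum_(be <- s) excess v t be).
Proof.
elim: s => [|be s IH].
  have -> : (fun t => \sum_(be <- [::]) excess v t be) = fun=> 0.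
    by apply/funext => t; rewrite big_nil.
  by move=> t; exact: cvg_cst.
have -> : (fun t => \sum_(i <- be :: s) excess v t i) =
    fun t => (v be - t + 0 + `|v be - t - 0|) / 2 + \sum_(i <- s) excess v t i.
  by apply/funext => t; rewrite big_cons /excess maxr_absE.
move=> t; apply: cvgD; last exact: IH.
apply: cvgM; last exact: cvg_cst.
have c1 : v be - t' @[t' --> t] --> v be - t by apply: cvgB; [exact: cvg_cst|exact: cvg_id].
apply: cvgD; first by apply: cvgD => //; exact: cvg_cst.
by apply: cvg_norm; apply: cvgB => //; exact: cvg_cst.
Qed.

(* Subtracting a threshold makes the support finite; choosing it by the mass
   that remains keeps the dependence on [v] Lipschitz in the l1 norm. *)
Let threshold v : (forall be, 0 <= v be) ->
  (forall s, uniq s -> \sum_(be <- s) v be <= 1) ->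
  (exists2 s, uniq s & 3 / 4 <= \sum_(be <- s) v be) ->
  exists t s0, [/\ 0 < t, uniq s0, forall be, t < v be -> be \in s0 &
    \sum_(be <- s0) excess v t be = 1 / 2].
Proof.
move=> v0 v1 [s us vs].
have v_le1 be : v be <= 1 by have := v1 [:: be] isT; rewrite big_seq1.
(* Subtracting [t0] from the entries of [s] loses at most [1 / 4] of their mass [3 / 4], so at least
   [1 / 2] remains. *)
pose t0 : R := (4 * (size s).+1%:R)^-1.
have t00 : 0 < t0 by rewrite invr_gt0 mulr_gt0.
have fin : finite_set [set be | t0 < v be].
  apply: contrapT => /(infinite_set_fset (4 * (size s).+1).+1)[F FB szF].
  have := v1 _ (fset_uniq F); apply/negP; rewrite -ltNge.
  apply: (@lt_le_trans _ _ (\sum_(be <- F) t0)).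
    rewrite big_const_seq count_predT iter_addr_0 -[ltRHS]mulr_natl.
    rewrite /t0 ltr_pdivlMr ?mulr_gt0// mul1r.
    by rewrite -natrM ltr_nat.
  by rewrite big_seq [leRHS]big_seq; apply: ler_sum => be /FB/ltW.
pose s0 : seq B := enum_fset (fset_set [set be | t0 < v be]).
have us0 : uniq s0 by exact: fset_uniq.
have s0P be : (be \in s0) = (t0 < v be) by rewrite in_fset_set// mem_setE.
have at0 : 1 / 2 <= \sum_(be <- s0) excess v t0 be.
  apply: (@le_trans _ _ (\sum_(be <- s) (v be - t0))).
    rewrite sumrB big_const_seq count_predT iter_addr_0.
    have : t0 *+ size s <= 1 / 4.
      rewrite -[leLHS]mulr_natl /t0 ler_pdivrMr ?mulr_gt0//.
      by rewrite mulrA divfK ?pnatr_eq0// mul1r ler_nat.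
    by lra.
  rewrite (bigID (mem s0))/= -[leRHS]addr0 lerD//; last first.
    by apply: sumr_le0 => be; rewrite s0P -leNgt subr_le0.
  apply: (@le_trans _ _ (\sum_(be <- s | be \in s0) excess v t0 be)).
    by apply: ler_sum => be _; rewrite /excess le_max lexx.
  rewrite [leRHS](bigID (mem s))/= -[leLHS]addr0 lerD//; last exact: sumr_ge0.
  rewrite le_eqVlt; apply/orP; left; apply/eqP.
  rewrite -[LHS]big_filter -[RHS]big_filter; apply: perm_big; apply: uniq_perm; rewrite ?filter_uniq// => be.
  by rewrite !mem_filter andbC.
have t01 : t0 <= 1.
  rewrite invf_le1 ?mulr_gt0//.
  by have : 1 <= (size s).+1%:R :> R by [rewrite ler1n]; lra.
have at1 : \sum_(be <- s0) excess v 1 be = 0.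
  by apply: big1 => be _; rewrite /excess max_r// subr_le0.
(* The remaining mass is at least [1 / 2] at [t0] and 0 at threshold 1. *)
have [||t tin tE] := @IVT R (fun t => \sum_(be <- s0) excess v t be) t0 1 (1 / 2) t01.
- exact/continuous_subspaceT/sum_excess_continuous.
- by rewrite at1 ge_min le_max at0/= orbC; apply/andP; split => //; rewrite divr_ge0.
exists t, s0; move: tin; rewrite in_itv/= => /andP[t0t t1]; split => //.
- exact: lt_le_trans t0t.
- by move=> be; rewrite s0P; exact: le_lt_trans.
Qed.

(** The weights are twice the excesses, which have mass [1 / 2]. If [t m' <= t m], lowering the
    threshold of [w m] to [t m'] changes its excess by a difference of masses of two excesses at the
    same threshold, at most [K]; comparing these two excesses costs another [K]. Doubling gives
    [4 * K]. *)
Lemma finite_weights (M : Type) (w : M -> B -> R) :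
  (forall m be, 0 <= w m be) ->
  (forall m s, uniq s -> \sum_(be <- s) w m be <= 1) ->
  (forall m, exists2 s, uniq s & 3 / 4 <= \sum_(be <- s) w m be) ->
  exists u : M -> B -> R, [/\ forall m, is_weight (u m),
    forall m be, u m be != 0 -> w m be != 0 &
    forall m m' K, (forall s, uniq s -> \sum_(be <- s) `|w m be - w m' be| <= K) ->
      forall s, uniq s -> \sum_(be <- s) `|u m be - u m' be| <= 4 * K].
Proof.
move=> w0 w1 w34.
have /choice[ts tsP] m : exists ts : R * seq B,
    [/\ 0 < ts.1, uniq ts.2, forall be, ts.1 < w m be -> be \in ts.2 &
      \sum_(be <- ts.2) excess (w m) ts.1 be = 1 / 2].
  by have [t [s ?]] := threshold (w0 m) (w1 m) (w34 m); exists (t, s).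
pose t m := (ts m).1; pose s0 m := (ts m).2.
have t0 m : 0 < t m by have [] := tsP m.
have us0 m : uniq (s0 m) by have [] := tsP m.
have s0P m be : be \notin s0 m -> excess (w m) (t m) be = 0.
  have [_ _ h _] := tsP m => bes0; rewrite /excess max_r// subr_le0 leNgt.
  by apply: contra bes0 => /h.
have half m : \sum_(be <- s0 m) excess (w m) (t m) be = 1 / 2 by have [] := tsP m.
have half_widen m s : uniq s -> {subset s0 m <= s} ->
    \sum_(be <- s) excess (w m) (t m) be = 1 / 2.
  move=> us sub; rewrite -(half m) (bigID (mem (s0 m)))/=.
  rewrite [X in _ + X]big1 ?addr0; last by move=> be; exact: s0P.
  rewrite -big_filter; apply/perm_big/uniq_perm; rewrite ?filter_uniq// => be.
  by rewrite mem_filter andb_idr// => /sub.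
pose u m be := 2 * excess (w m) (t m) be.
have uw m : is_weight (u m).
  have ufin : finite_set [set be | u m be != 0].
    apply: (sub_finite_set (B := [set` s0 m])); last exact: finite_seq.
    move=> be /= une; apply: contraNT une => /s0P h.
    by rewrite /u h mulr0.
  have u0 be : 0 <= u m be by rewrite mulr_ge0.
  split=> //; rewrite -[RHS](_ : 2 * (1 / 2) = 1); last by field.
  rewrite -(half m) mulr_sumr.
  rewrite [RHS](bigID (fun be => u m be != 0))/= [X in _ = _ + X]big1 ?addr0; last first.
    by move=> be; rewrite negbK => /eqP.
  rewrite -[RHS]big_filter; apply/perm_big/uniq_perm.
  - exact: fset_uniq.
  - exact: filter_uniq.
  move=> be; rewrite in_fset_set// mem_setE mem_filter andb_idr//.
  by move=> une; apply: contraNT une => /s0P h; rewrite /u h mulr0.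
exists u; split => //.
  move=> m be; apply: contra => /eqP wE.
  by rewrite /u /excess wE sub0r max_r ?mulr0// oppr_le0 ltW.
move=> m m' K wK s us.
wlog tt : m m' wK / t m' <= t m => [H|].
  have [h|/ltW h] := leP (t m') (t m); first exact: H.
  have -> : \sum_(be <- s) `|u m be - u m' be| = \sum_(be <- s) `|u m' be - u m be|.
    by apply: eq_bigr => be _; rewrite distrC.
  apply: H => // s' us'; rewrite (le_trans _ (wK s' us'))//.
  by apply: ler_sum => be _; rewrite distrC.
pose s1 := undup (s ++ s0 m ++ s0 m').
have us1 : uniq s1 by exact: undup_uniq.
apply: (@le_trans _ _ (\sum_(be <- s1) `|u m be - u m' be|)).
  rewrite [leRHS](bigID (mem s))/= -[leLHS]addr0 lerD//; last exact: sumr_ge0.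
  rewrite le_eqVlt; apply/orP; left; apply/eqP.
  rewrite -[RHS]big_filter; apply/perm_big/uniq_perm; rewrite ?filter_uniq// => be.
  by rewrite mem_filter mem_undup mem_cat; case: (be \in s).
have e1 : \sum_(be <- s1) excess (w m) (t m) be = 1 / 2.
  by apply: half_widen => // be; rewrite mem_undup !mem_cat => ->; rewrite orbT.
have e2 : \sum_(be <- s1) excess (w m') (t m') be = 1 / 2.
  by apply: half_widen => // be; rewrite mem_undup !mem_cat => ->; rewrite !orbT.
have qr : \sum_(be <- s1) `|excess (w m) (t m') be - excess (w m') (t m') be| <= K.
  by apply: le_trans (wK s1 us1); apply: ler_sum => be _; exact: excess_dist.
have pq : \sum_(be <- s1) `|excess (w m) (t m) be - excess (w m) (t m') be| <= K.
  apply: le_trans qr.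
  have -> : \sum_(be <- s1) `|excess (w m) (t m) be - excess (w m) (t m') be| =
      \sum_(be <- s1) (excess (w m) (t m') be - excess (w m') (t m') be).
    rewrite sumrB e2 -e1 -sumrB; apply: eq_bigr => be _.
    by rewrite distrC ger0_norm// subr_ge0 excess_le.
  by apply: ler_sum => be _; exact: ler_norm.
apply: (@le_trans _ _ (\sum_(be <- s1)
    2 * (`|excess (w m) (t m) be - excess (w m) (t m') be| +
      `|excess (w m) (t m') be - excess (w m') (t m') be|))).
  apply: ler_sum => be _; rewrite /u -mulrBr normrM ger0_norm// ler_wpM2l//.
  exact: ler_distD.
by rewrite -mulr_sumr big_split/=; lra.
Qed.

End SoftThreshold.

(** * Weights on one factor and a lower bound for its doubling constant *)

Section FactorWeights.
Context {R : realType} {M : pmetricType R}.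
Variable mu : M -> {measure set (borel M) -> \bar R}.
Hypothesis mu_ph : pointwise_homogeneous mu.
Local Notation C := (consistency_constant mu).
Local Notation D := (doubling_constant mu).

(** [radial_weights] at [a = r / 2]: the 8 is 4 from the soft threshold times 2 from the halved
    radius. *)
Lemma gentle_weights (r : R) : 0 < r ->
  exists u : M -> M * set (borel M) -> R,
  [/\ forall m, is_weight (u m),
      forall m be, u m be != 0 -> mdist m be.1 <= 2 * r &
      forall m m' (s : seq (M * set (borel M))), uniq s ->
        \sum_(be <- s) `|u m be - u m' be| <=
        8 * (2 * C + 24 * ln D + 8) * (mdist m m' / r)].
Proof.
move=> r0; have r2 : 0 < r / 2 by rewrite divr_gt0.
have [w [w0 w1 w34 wd wK]] := radial_weights mu_ph r2.
have [u [u1 u2 u3]] := finite_weights w0 w1 w34.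
exists u; split => //.
  by move=> m be /u2/wd; rewrite (_ : 4 * (r / 2) = 2 * r)//; field.
move=> m m' s us; have := u3 m m' _ (fun s us => wK m m' s us) s us.
set K := 2 * C + _ + _; rewrite (_ : 4 * _ = 8 * K * (mdist m m' / r))//.
by field; rewrite gt_eqF.
Qed.

(** The disjoint balls of radius [d / 2] about [m] and [m'] both lie in each ball of radius [2 * d],
    two doublings away. With masses [x] and [y] this gives [x + y <= D ^+ 2 * x] and the same with
    [y]; adding the two proves the claim. *)
Let equal_masses_doubling (m m' : M) : m <> m' ->
  (forall (A : set (borel M)) (r : R), measurable A -> 0 < r ->
    mass mu m (A `&` ball m r) = mass mu m' (A `&` ball m r)) -> 2 <= D ^+ 2.
Proof.
move=> mm' eqm; pose d := mdist m m'.
have d0 : 0 < d by rewrite mdist_gt0; exact/eqP.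
have d2 : 0 < d / 2 by rewrite divr_gt0.
have d4 : 0 < 2 * d by rewrite mulr_gt0.
have sub (n n' : M) : mdist n n' = d -> ball n' (d / 2) `<=` ball n (2 * d).
  move=> nn' x; rewrite !ballEmdist/= => n'x.
  by rewrite (le_lt_trans (metric_triangle _ n' _))// nn'; lra.
have subm (n : M) : ball n (d / 2) `<=` ball n (2 * d) by apply: subset_ball_le; lra.
have m'm : mdist m' m = d by rewrite metric_sym.
have disj : ball m (d / 2) `&` ball m' (d / 2) = set0.
  rewrite -subset0 => x []; rewrite !ballEmdist/= => mx m'x.
  by have := metric_triangle m x m'; rewrite (metric_sym x) -/d; lra.
have mb (n : M) (t : R) := measurable_ball n t.
have add (n : M) (U : set (borel M)) : bounded_meas U -> ball m (d / 2) `<=` U -> ball m' (d / 2) `<=` U ->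
    mass mu n (ball m (d / 2)) + mass mu n (ball m' (d / 2)) <= mass mu n U.
  move=> bU s1 s2; rewrite -lee_fin EFinD !(massE mu_ph)//; try exact: bounded_ball.
  rewrite -[leLHS]measureU//; apply: le_measure.
  - by apply: mem_set; exact: measurableU.
  - by apply: mem_set; case: bU.
  - by move=> x [/s1|/s2].
have e1 : mass mu m (ball m' (d / 2)) = ball_mass mu m' (d / 2).
  have := eqm _ _ (mb m' (d / 2)) d4.
  by rewrite setIidl//; exact: sub.
have e2 : mass mu m' (ball m (d / 2)) = ball_mass mu m (d / 2).
  by have := eqm _ _ (mb m (d / 2)) d4; rewrite setIidl.
have := add m _ (bounded_ball m (2 * d)) (subm m) (sub _ _ erefl).
have := add m' _ (bounded_ball m' (2 * d)) (sub _ _ m'm) (subm m').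
rewrite e1 e2 -/(ball_mass mu m (d / 2)) -/(ball_mass mu m' (d / 2)).
rewrite -/(ball_mass mu m (2 * d)) -/(ball_mass mu m' (2 * d)).
have dbl (n : M) : ball_mass mu n (2 * d) <= D ^+ 2 * ball_mass mu n (d / 2).
  have D0 : 0 <= D by rewrite (le_trans _ (doubling_constant_ge1 mu_ph)).
  have := ball_mass_double mu_ph n d2; have := ball_mass_double mu_ph n d0.
  have -> : 2 * (d / 2) = d by field.
  move=> h1 /(ler_wpM2l D0) h2; rewrite (le_trans h1)// (le_trans h2)//.
  by rewrite expr2 mulrA.
have := dbl m; have := dbl m'.
have := ball_mass_gt0 mu_ph m d2; have := ball_mass_gt0 mu_ph m' d2.
set x := ball_mass mu m (d / 2); set y := ball_mass mu m' (d / 2).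
move=> y0 x0 h1 h2 h3 h4; rewrite -(ler_pM2r (addr_gt0 x0 y0)); lra.
Qed.

(* If [mu m] and [mu m'] differ, consistency forces the masses of large balls to
   grow at least linearly; if they agree, two disjoint balls fit in one. *)
Lemma doubling_constant_sqr_ge2 (m m' : M) : m <> m' -> 2 <= D ^+ 2.
Proof.
move=> mm'; have [eqm|] := pselect (forall (A : set (borel M)) (r : R), measurable A -> 0 < r ->
    mass mu m (A `&` ball m r) = mass mu m' (A `&` ball m r)).
  exact: equal_masses_doubling mm' eqm.
move=> /existsNP[A /existsNP[r /not_implyP[mA /not_implyP[r0 /eqP ne]]]].
have D1 := doubling_constant_ge1 mu_ph.
have [D2|D2] := leP 2 D; first by rewrite expr2; nra.
exfalso.
pose e := `|mass mu m (A `&` ball m r) - mass mu m' (A `&` ball m r)|.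
have e0 : 0 < e by rewrite normr_gt0 subr_eq0.
have mb := measurable_ball m r.
pose F (i : 'I_2) := if i == ord0 then A `&` ball m r else ~` (A `&` ball m r).
have mF i : measurable (F i).
  by rewrite /F; case: ifP => _; [exact: measurableI|exact/measurableC/measurableI].
have tF : trivIset setT F.
  apply/trivIsetP => -[[|[|//]] i] [[|[|//]] j] _ _ //= _; rewrite /F/=.
    exact: setICr.
  exact: setICl.
have FT : \bigcup_i F i = setT.
  apply/seteqP; split => // x _; have [xA|xA] := pselect ((A `&` ball m r) x).
    by exists ord0.
  by exists (lift ord0 ord0).
have growth (s : R) : r <= s -> e * s <= C * mdist m m' * ball_mass mu m s.
  move=> rs; have s0 : 0 < s by exact: lt_le_trans rs.
  have := consistency_partition mu_ph (m2 := m') s0 (or_introl (erefl m)) mF tF FT.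
  rewrite big_ord_recl {1 2}/F/= -setIA (setIidl (subset_ball_le rs)) -/e => h.
  have {}h : e <= C * (ball_mass mu m s / s * mdist m m').
    by apply: le_trans h; rewrite lerDl; apply: sumr_ge0.
  have := ler_wpM2r (ltW s0) h.
  rewrite (_ : C * _ * s = C * mdist m m' * ball_mass mu m s)//.
  by field; rewrite gt_eqF.
have pow k : ball_mass mu m (2 ^+ k * r) <= D ^+ k * ball_mass mu m r.
  elim: k => [|k IH]; first by rewrite !expr0 !mul1r.
  rewrite !exprS -!mulrA (le_trans (ball_mass_double mu_ph m _))//.
    by rewrite mulr_gt0// exprn_gt0.
  by rewrite ler_wpM2l// (le_trans _ D1).
pose K := C * mdist m m' * ball_mass mu m r.
(* Linear growth along the radii [2 ^+ k * r] against growth by at most [D] per doubling; the right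
   side tends to 0 because [D < 2]. *)
have bound k : e * r <= K * (D / 2) ^+ k.
  have rk : r <= 2 ^+ k * r by rewrite ler_peMl ?(ltW r0)// exprn_ege1// ler1n.
  have h := growth _ rk; have CC : 0 <= C * mdist m m'.
    by rewrite mulr_ge0 ?mdist_ge0// consistency_constant_ge0.
  have := le_trans h (ler_wpM2l CC (pow k)).
  have p0 : 0 < 2 ^+ k :> R by exact: exprn_gt0.
  rewrite expr_div_n [K * _]mulrA ler_pdivlMr//.
  rewrite (_ : e * (2 ^+ k * r) = e * r * 2 ^+ k); last by ring.
  by rewrite (_ : C * _ * _ = K * D ^+ k)//; rewrite /K; ring.
have K0 : 0 <= K.
  rewrite mulr_ge0 ?mass_ge0// mulr_ge0 ?mdist_ge0//.
  exact: consistency_constant_ge0.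
have z1 : `|D / 2| < 1 by rewrite ger0_norm ?divr_ge0 ?(le_trans _ D1)//; lra.
have er0 : 0 < e * r / (K + 1) by rewrite divr_gt0 ?mulr_gt0// ltr_wpDl.
have [k _ /(_ k (leqnn k))/=] := cvgr_dist_lt _ _ (cvg_expr z1) _ er0.
rewrite sub0r normrN ger0_norm ?exprn_ge0 ?divr_ge0 ?(le_trans _ D1)//.
rewrite ltr_pdivlMr ?ltr_wpDl//; have := bound k.
have : 0 <= (D / 2) ^+ k by rewrite exprn_ge0// divr_ge0// (le_trans _ D1).
by set z := _ ^+ k; lra.
Qed.

End FactorWeights.

(** * Averages on the product *)

Section ProductAverages.
Context {R : realType} (N : nat) (M : 'I_N -> pmetricType R).
Variables (mu : forall i, M i -> {measure set (borel (M i)) -> \bar R}).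
Variables (p q : \bar R).
Hypotheses (p1 : (1 <= p)%E) (pq : (p^-1 + q^-1 = 1)%E).
Hypothesis mu_ph : forall i, pointwise_homogeneous (@mu i).
Local Notation D i := (doubling_constant (@mu i)).
Local Notation C i := (consistency_constant (@mu i)).

Let ln2_gt0 : 0 < ln 2 :> R.
Proof. by rewrite ln_gt0// ltr1n. Qed.

Let ln2_le1 : ln 2 <= 1 :> R.
Proof. by have := @expR_ge1Dx R (ln 2); rewrite lnK ?posrE//; lra. Qed.

(* The radius of the averaging in the i-th factor at scale [t] is
   [t * (dim i / dim_sum) ^ (1/p)], where [dim i] is the doubling exponent. *)
Let dim i : R := ln (D i) / ln 2.
(** The summand 1 keeps the denominator positive and matches the [+ 1] after the logarithm in the
    final bound. *)
Let dim_sum : R := 1 + \sum_(i < N) dim i.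
Let v i : R := dim i / dim_sum.
Let single i := forall x y : M i, x = y.
(** A one-point factor may have exponent 0, which could give radius 0; there any positive radius
    serves, since all distances vanish. *)
Let alpha i : R := if pselect (single i) then 1 else v i `^ fine p^-1.

Let D1 i : 1 <= D i := doubling_constant_ge1 (@mu_ph i).
Let C0 i : 0 <= C i := consistency_constant_ge0 (@mu i).

Let dim_ge0 i : 0 <= dim i.
Proof. by rewrite divr_ge0 ?(ltW ln2_gt0)// ln_ge0. Qed.

Let dim_sum_ge1 : 1 <= dim_sum.
Proof. by rewrite lerDl sumr_ge0. Qed.

Let dim_sum_gt0 : 0 < dim_sum.
Proof. exact: lt_le_trans dim_sum_ge1. Qed.

Let v_ge0 i : 0 <= v i.
Proof. by rewrite divr_ge0 ?(ltW dim_sum_gt0). Qed.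

Let v_sum : \sum_(i < N) v i <= 1.
Proof. by rewrite -mulr_suml ler_pdivrMr// mul1r lerDr. Qed.

Let v_le1 i : v i <= 1.
Proof. by rewrite (le_trans _ v_sum)// (bigD1 i)//= lerDl sumr_ge0. Qed.

Let dim_half i : ~ single i -> 1 / 2 <= dim i.
Proof.
move=> /existsNP[x /existsNP[y xy]].
have := doubling_constant_sqr_ge2 (@mu_ph i) xy.
have D0 : 0 < D i by exact: lt_le_trans (D1 i).
rewrite -ler_ln ?posrE ?exprn_gt0// lnXn// /dim ler_pdivlMr// (mulr2n (ln (D i))); lra.
Qed.

Let alphaE i : ~ single i -> alpha i = v i `^ fine p^-1.
Proof. by rewrite /alpha; case: pselect. Qed.

Let alpha_gt0 i : 0 < alpha i.
Proof.
rewrite /alpha; case: pselect => // ns; rewrite powR_gt0// divr_gt0//.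
by rewrite (lt_le_trans _ (dim_half ns)).
Qed.

Let q1 : (1 <= q)%E := conjugate_ge1 p1 pq.

Let fine_conj : fine q^-1 = 1 - fine p^-1 /\ 0 <= fine p^-1 <= 1.
Proof.
have [[-> ->]|[-> ->]|[r [s [r1 s1 rs -> ->]]]] := conjugate_cases p1 pq.
- by rewrite invey inve1/= subrr ler01 lexx.
- by rewrite invey inve1/= subr0 lexx ler01.
- rewrite !fine_invr; split; first by move: rs; set x := r^-1; set y := s^-1; lra.
  by rewrite invr_ge0 (le_trans ler01 (ltW r1)) invf_le1 ?(ltW r1)// (lt_trans ltr01).
Qed.

Let mdist_single i (x y : M i) : single i -> mdist x y = 0.
Proof. by move=> s; rewrite (s x y) mdistxx. Qed.

Let psum_near (x y : forall i, M i) (t : R) (e : 'I_N -> R) :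
  0 < t -> (forall i, 0 <= e i) ->
  (forall i, mdist (x i) (y i) <= 2 * (t * alpha i) + e i) ->
  psum_dist p x y <= 2 * t + psum_norm p e.
Proof.
move=> t0 e0 xy.
have t20 : 0 <= 2 * t by rewrite mulr_ge0// ltW.
have w0 i : 0 <= v i `^ fine p^-1 by exact: powR_ge0.
apply: (@le_trans _ _ (psum_norm p (fun i => 2 * t * v i `^ fine p^-1 + e i))).
  apply: ler_psum_norm => // i; first exact: mdist_ge0.
  have [s|ns] := pselect (single i).
    by rewrite mdist_single// addr_ge0// mulr_ge0.
  by have := xy i; rewrite alphaE// mulrA.
have w2 i : 0 <= 2 * t * v i `^ fine p^-1 by rewrite mulr_ge0.
rewrite (le_trans (psum_norm_triangle p1 w2 e0))// lerD2r (le_trans (psum_normZ p1 w0 t20))//.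
by rewrite ler_piMr// psum_norm_root.
Qed.

Lemma product_means (X : normedModType R) :
  let Lam := 640 * (psum_norm q (fun i => C i) + 1) * dim_sum in
  exists A : R -> ((forall i, M i) -> X) -> (forall i, M i) -> X,
  [/\ forall (t : R) a g h x, 0 < t ->
        A t (fun y => a *: g y + h y) x = a *: A t g x + A t h x,
      forall (t : R) g x c (b : R), 0 < t ->
        (forall y, psum_dist p x y <= 2 * t -> `|g y - c| <= b) ->
        `|A t g x - c| <= b &
      forall (t : R) g x x' c (b : R), 0 < t ->
        (forall y, psum_dist p x y <= 2 * t + psum_dist p x x' -> `|g y - c| <= b) ->
        `|A t g x - A t g x'| <= Lam * psum_dist p x x' / t * b].
Proof.
move=> Lam.
pose cell i := (M i * set (borel (M i)))%type.
have /choice[u uP] (t : R) : exists u : forall i, M i -> cell i -> R, 0 < t -> forall i,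
    [/\ forall m, is_weight (u i m),
      forall m be, u i m be != 0 -> mdist m be.1 <= 2 * (t * alpha i) &
      forall m m' (s : seq (cell i)), uniq s ->
        \sum_(be <- s) `|u i m be - u i m' be| <=
        8 * (2 * C i + 24 * ln (D i) + 8) * (mdist m m' / (t * alpha i))].
  have [t0|t0] := ltP 0 t; last first.
    by exists (fun i m be => 0).
  have ta i : 0 < t * alpha i by rewrite mulr_gt0.
  pose u i := cid (gentle_weights (@mu_ph i) (ta i)).
  by exists (fun i => sval (u i)) => _ i; exact: (svalP (u i)).
pose b i (be : cell i) := be.1.
(* Every coordinate is replaced, so [x] enters only through the weights and the starting point is an
   arbitrary constant. *)
pose A (t : R) (g : (forall i, M i) -> X) (x : forall i, M i) :=
  coord_avg b (fun i => u t i (x i)) (enum 'I_N) g (fun=> point).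
have dm := psum_dist_is_metric M p1.
exists A; split.
- by move=> t a g h x t0; rewrite /A coord_avg_linear.
- move=> t g x c r t0 gr; apply: coord_avg_mean.
  + by move=> i; have [] := uP t t0 i.
  + exact: enum_uniq.
  move=> y yu _; apply: gr; rewrite -[leRHS]addr0 -(psum_norm0 p1 (N := N)).
  apply: psum_near => // i; rewrite addr0.
  have [be ube ->] := yu i (mem_enum _ _); have [_ ud _] := uP t t0 i.
  exact: ud.
- move=> t g x x' c r t0 gr.
  have r0 : 0 <= r.
    apply: le_trans (gr x _); first exact: normr_ge0.
    have -> : psum_dist p x x = 0 by case: dm.
    by rewrite addr_ge0 ?(is_metric_ge0 dm)// mulr_ge0// ltW.
  pose e i := 8 * (2 * C i + 24 * ln (D i) + 8) * (mdist (x i) (x' i) / (t * alpha i)).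
  apply: (@le_trans _ _ (\sum_(i <- enum 'I_N) e i * r)).
    apply: coord_avg_dist => //.
    + by move=> i; have [] := uP t t0 i.
    + by move=> i; have [] := uP t t0 i.
    + exact: enum_uniq.
    + by move=> i s us; have [_ _] := uP t t0 i; apply.
    move=> y yu _; apply: gr; apply: psum_near => // i; first exact: mdist_ge0.
    have [be ube ->] := yu i (mem_enum _ _); have [_ ud _] := uP t t0 i.
    have [/ud h|/ud h] := orP ube; first by rewrite (le_trans h)// lerDl mdist_ge0.
    rewrite (le_trans (metric_triangle _ (x' i) _))// addrC lerD2r.
    exact: h.
  rewrite big_enum/= -mulr_suml ler_wpM2r//.
  pose di i := mdist (x i) (x' i).
  have di0 i : 0 <= di i := mdist_ge0 _ _.
  have [fq /andP[pi0 pi1]] := fine_conj.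
  have t320 : 0 <= 320 / t by apply: divr_ge0; [exact: ler0n|exact: ltW].
  have e_le i : e i <= 320 / t *
      (2 * dim_sum * (di i * C i) + dim_sum * (di i * v i `^ fine q^-1)).
    have rhs0 : 0 <= 320 / t *
        (2 * dim_sum * (di i * C i) + dim_sum * (di i * v i `^ fine q^-1)).
      apply: mulr_ge0; first exact: t320.
      apply: addr_ge0; apply: mulr_ge0.
      - by apply: mulr_ge0 => //; exact: ltW.
      - exact: mulr_ge0.
      - exact: ltW.
      - by apply: mulr_ge0 => //; exact: powR_ge0.
    have [s|ns] := pselect (single i).
      by rewrite /e mdist_single// mul0r mulr0.
    have half := dim_half ns.
    have v0 : 0 < v i by rewrite divr_gt0// (lt_le_trans _ half).
    have aE := alphaE ns.
    have a0 := alpha_gt0 i.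
    have aV : (alpha i)^-1 <= 2 * dim_sum.
      apply: (@le_trans _ _ (v i)^-1).
        rewrite lef_pV2 ?posrE// aE -[leLHS]powRr1 ?(ltW v0)//.
        by apply: ger_powR => //; rewrite v0 v_le1.
      rewrite /v invf_div ler_pdivrMr ?(lt_le_trans _ half)//.
      by have := ler_wpM2l (ltW dim_sum_gt0) half; lra.
    have dimE : dim i / alpha i = dim_sum * v i `^ fine q^-1.
      have vE : v i = v i `^ fine q^-1 * alpha i.
        rewrite aE -powRD fq ?subrK ?powRr1 ?(ltW v0)//.
        by rewrite (gt_eqF v0) implybT.
      have dv : dim i = dim_sum * v i by rewrite mulrC divfK// gt_eqF.
      by rewrite dv {1}vE mulrA mulfK// gt_eqF.
    have lnE : ln (D i) = ln 2 * dim i by rewrite mulrC divfK// gt_eqF.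
    have lnD : ln (D i) <= dim i by rewrite lnE ler_piMl.
    (* Since [dim i >= 1 / 2], the constant 64 is at most [128 * dim i], and [192 + 128 = 320]. *)
    have K : 8 * (2 * C i + 24 * ln (D i) + 8) <= 320 * (C i + dim i).
      by have := C0 i; lra.
    have dta : 0 <= di i / (t * alpha i) by rewrite divr_ge0// mulr_ge0 ?ltW.
    rewrite (le_trans (ler_wpM2r dta K))//.
    have -> : 320 * (C i + dim i) * (di i / (t * alpha i)) =
        320 / t * (di i * C i * (alpha i)^-1 + di i * (dim i / alpha i)).
      by field; rewrite !gt_eqF.
    rewrite dimE; apply: ler_wpM2l; first exact: t320.
    apply: lerD; last by rewrite mulrCA.
    by rewrite mulrC; apply: ler_wpM2r => //; exact: mulr_ge0.
  rewrite (le_trans (ler_sum _ (fun i _ => e_le i)))//.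
  rewrite -mulr_sumr big_split/= -!mulr_sumr.
  have dp0 : 0 <= psum_dist p x x' := is_metric_ge0 dm x x'.
  have h1 := hoelder_psum p1 pq di0 C0.
  have h2 : \sum_(i < N) di i * v i `^ fine q^-1 <= psum_dist p x x'.
    rewrite (le_trans (hoelder_psum p1 pq di0 (fun i => powR_ge0 _ _)))//.
    by rewrite ler_piMr ?psum_norm_ge0// psum_norm_root.
  have n0 := ltW dim_sum_gt0.
  have h3 := ler_wpM2l n0 h1; have h4 := ler_wpM2l n0 h2.
  rewrite [leLHS]mulrAC ler_wpM2r ?invr_ge0 ?(ltW t0)//.
  have := mulr_ge0 n0 dp0; rewrite /Lam -/(psum_dist p x x') in h3 *.
  by move: h3 h4; set Q := psum_norm q _; set y := psum_dist p x x';
    set z := \sum_(_ < _) _; set z' := \sum_(_ < _) _; lra.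
Qed.

End ProductAverages.

(** * Assembly of the extension operator and its constant *)

Theorem theorem1p14 (R : realType) :
  exists c0 : R,
  forall (N : nat) (p q : \bar R) (M : 'I_N -> pmetricType R)
    (mu : forall i, M i -> {measure set (borel (M i)) -> \bar R})
    (K : 'I_N -> R),
  (1 <= N)%N ->
  (1 <= p)%E ->
  (p^-1 + q^-1 = 1)%E ->
  (forall i, pointwise_homogeneous (mu i)) ->
  (forall i, 1 <= K i) ->
  (forall i, uniform_family (mu i) (K i)) ->
  forall (S : set (forall i, M i)) (X : completeNormedModType R),
  let D := \prod_(i < N) doubling_constant (mu i) in
  let C := psum_norm q (fun i => consistency_constant (mu i))
           * \prod_(i < N) K i in
  (extension_constant (psum_dist p) S X
    <= (c0 * (C + 1) * (ln D / ln 2 + 1))%:E)%E.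
Proof.
(* 200 comes from gluing the scales in [extension_from_means], 640 from the averages in
   [product_means]. *)
exists (200 * 640) => N p q M mu K N1 p1 pq mu_ph K1 _ S X /=.
set D := \prod_(i < N) doubling_constant _; set C := psum_norm q _ * _.
have [A [Alin Amean Alip]] := product_means p1 pq mu_ph X.
set Lam := 640 * _ * _ in Alip.
have dm := psum_dist_is_metric M p1.
have D1 i : 1 <= doubling_constant (mu i) := doubling_constant_ge1 (@mu_ph i).
have Dpos i : 0 < doubling_constant (mu i) by exact: lt_le_trans (D1 i).
have lnD : ln D / ln 2 + 1 = 1 + \sum_(i < N) ln (doubling_constant (mu i)) / ln 2.
  rewrite addrC -mulr_suml; congr (_ + _ / _); rewrite /D.
  suff [] : 0 < \prod_(i < N) doubling_constant (mu i) /\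
      ln (\prod_(i < N) doubling_constant (mu i)) =
      \sum_(i < N) ln (doubling_constant (mu i)) by [].
  elim/big_rec2: _ => [|i x y _ [y0 yE]]; first by rewrite ln1.
  by rewrite mulr_gt0// lnM ?posrE// yE.
(* The product of the [K i] is at least 1, so [C] dominates the q-norm of the consistency
   constants. *)
have Csum : psum_norm q (fun i => consistency_constant (mu i)) <= C.
  rewrite ler_peMr ?psum_norm_ge0//.
  by elim/big_ind : _ => // x y x1 y1; rewrite mulr_ege1.
have n1 : 1 <= ln D / ln 2 + 1.
  rewrite lnD lerDl sumr_ge0// => i _.
  by apply: divr_ge0; apply: ln_ge0; rewrite ?ler1n.
have Lam1 : 1 <= Lam.
  rewrite /Lam -lnD; have := psum_norm_ge0 q (fun i => consistency_constant (mu i)).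
  by move: n1; set n := ln D / _ + 1; set Q := psum_norm _ _; nra.
have := extension_from_means S dm Lam1 Alin Amean Alip.
move=> /le_trans; apply; rewrite lee_fin /Lam -lnD.
have n0 := le_trans ler01 n1.
rewrite !mulrA; apply: ler_wpM2r => //; apply: ler_wpM2l; last by rewrite lerD2r.
by apply: mulr_ge0; exact: ler0n.
Qed.
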